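(* Let $n \in \mathbb{N}$, $n \geq 2$, be arbitrary and let $\mathcal{POR}_{n}$ be the monoid of orientation-preserving and orientation-reversing partial transformations on $\{1,\ldots,n\}$ with the usual order. Then the maximal subsemigroups of $\mathcal{POR}_{n}$ are precisely: (a) $(\mathcal{POR}_{n} \setminus \mathcal{D}_{n}) \cup L$, where $L$ is a maximal subgroup of the group $\mathcal{D}_{n}$ (type (M5)); (b) $\mathcal{POR}_{n} \setminus \{\alpha \in \mathcal{OR}_{n} : \operatorname{rank}(\alpha) = n - 1\}$ (type (M4)); and (c) $\mathcal{POR}_{n} \setminus \{\alpha \in \mathcal{PORI}_{n} : \operatorname{rank}(\alpha) = n - 1\}$ (type (M4)). In particular, there are $3$ maximal subsemigroups of $\mathcal{POR}_{2}$, and for $n \geq 3$, there are $\sum_{p \in \mathbb{P}_{n}} p + 3$ maximal subsemigroups of $\mathcal{POR}_{n}$, where $\mathbb{P}_{n}$ is the set of the primes that divide $n$. The monoid $\mathcal{POR}_{1} = \mathcal{PT}_{1}$ is a semilattice of order $2$: its maximal subsemigroups are each of its singleton subsets.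
   Context: $\mathbb{N}=\{1,2,3,\ldots\}$. A maximal subsemigroup of a semigroup $S$ (maximal subgroup of a group) is a proper subsemigroup (subgroup) not contained in any other proper one. A semilattice is a commutative semigroup of idempotents. $\mathcal{PT}_n$ is the monoid of all partial maps from $\{1,\ldots,n\}$ to itself (partial transformations) under composition, maps written on the right. A transformation is an element with domain $\{1,\ldots,n\}$; a partial permutation is an injective element. $\operatorname{rank}(\alpha)=|\operatorname{im}(\alpha)|$. If $\operatorname{dom}(\alpha)=\{i_1<\cdots<i_k\}$, put $i_{k+1}=i_1$; $\alpha$ is orientation-preserving if there is at most one $l\in\{1,\ldots,k\}$ with $i_l\alpha>i_{l+1}\alpha$, and orientation-reversing if there is at most one $l\in\{1,\ldots,k\}$ with $i_l\alpha<i_{l+1}\alpha$. $\mathcal{OR}_n$ is the set of transformations in $\mathcal{POR}_n$, and $\mathcal{PORI}_n$ is the set of partial permutations in $\mathcal{POR}_n$. $\mathcal{D}_n=\langle (1\ 2\ \ldots\ n),\gamma_n\rangle$, where $i\gamma_n=n-i+1$ for all $i$; it is the group of units of $\mathcal{POR}_n$ (dihedral of order $2n$ when $n\ge 3$, and of order $2$ when $n=2$). Types: a maximal subsemigroup $M$ of a finite monoid $S$ arises from the $\mathscr{J}$-class $J$ if $S\setminus M\subseteq J$; when $J$ is regular, $M$ has type (M4) if $M\cap J$ is a non-empty union of $\mathscr{R}$-classes of $J$, and type (M5) if $M\cap J$ meets every $\mathscr{H}$-class of $J$. *)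

(* Defs.v *)
From mathcomp Require Import all_boot all_fingroup gseries.

Set Implicit Arguments.
Unset Strict Implicit.
Unset Printing Implicit Defensive.

(* The points 1, ..., n are represented by the ordinals 0, ..., n - 1, and   *)
(* a i = None means that the partial transformation a is undefined at i.     *)
Notation PT n := {ffun 'I_n -> option 'I_n}.

(* Maps act on the right: in pt_mul a b, a is applied first. *)
Definition pt_mul n (a b : PT n) : PT n := [ffun i => obind b (a i)].
Definition pt_one n : PT n := [ffun i => Some i].

Lemma pt_mulA n : associative (@pt_mul n).
Proof.
by move=> a b c; apply/ffunP=> i; rewrite !ffunE; case: (a i) => //= j; rewrite ffunE.
Qed.

Lemma pt_mul1r n : left_id (pt_one n) (@pt_mul n).
Proof. by move=> a; apply/ffunP=> i; rewrite !ffunE. Qed.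

Lemma pt_mulr1 n : right_id (pt_one n) (@pt_mul n).
Proof.
by move=> a; apply/ffunP=> i; rewrite !ffunE; case: (a i) => //= j; rewrite ffunE.
Qed.

Local Notation "a ** b" := (pt_mul a b) (at level 40, left associativity).

Section Semigroups.

Variable n : nat.
Local Notation T := (PT n).
Implicit Types (S M J : {set T}) (x y : T).

Definition subsemigroup S M : bool :=
  [&& M != set0, M \subset S & [forall x in M, forall y in M, x ** y \in M]].

Definition maximal_subsemigroup S M : bool :=
  maxset (fun N => subsemigroup S N && (N \proper S)) M.

Definition semilattice S : bool :=
  [&& subsemigroup S S, [forall x in S, forall y in S, x ** y == y ** x]
    & [forall x in S, x ** x == x]].

(* Green's relations of a submonoid S of PT n: since pt_one n belongs to S,  *)
(* no identity has to be adjoined to S when forming principal ideals.        *)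
Definition greenR S x y := [set x ** s | s in S] == [set y ** s | s in S].
Definition greenL S x y := [set s ** x | s in S] == [set s ** y | s in S].
Definition greenH S x y := greenR S x y && greenL S x y.
Definition greenJ S x y :=
  [set s ** x ** t | s in S, t in S] == [set s ** y ** t | s in S, t in S].

Definition classR S x : {set T} := [set y in S | greenR S x y].
Definition classH S x : {set T} := [set y in S | greenH S x y].
Definition classJ S x : {set T} := [set y in S | greenJ S x y].

Definition is_classJ S J : Prop := exists2 x, x \in S & J = classJ S x.

Definition regular_in S J : Prop :=
  forall x, x \in J -> exists2 y, y \in S & x ** y ** x = x.

Definition arises_from S M J : Prop :=
  [/\ maximal_subsemigroup S M, is_classJ S J & S :\: M \subset J].

Definition type_M4 S M : Prop :=
  exists J, [/\ arises_from S M J, regular_in S J, M :&: J != set0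
    & exists2 P : {set {set T}},
        P \subset [set classR S x | x in J] & M :&: J = cover P].

Definition type_M5 S M : Prop :=
  exists J, [/\ arises_from S M J, regular_in S J
    & forall x, x \in J -> M :&: classH S x != set0].

End Semigroups.

Section PartialTransformations.

Variable n : nat.
Implicit Types a : PT n.

Definition pt_dom a : {set 'I_n} := [set i | a i != None].
Definition pt_im a : {set 'I_n} := [set j | [exists i, a i == Some j]].
Definition pt_rank a : nat := #|pt_im a|.

(* The images, in order, of the points i_1 < ... < i_k of the domain. *)
Definition image_seq a : seq 'I_n := pmap a (enum 'I_n).

(* zip s (rot 1 s) lists the cyclically consecutive pairs (s_l, s_(l+1)),    *)
(* including the pair (s_k, s_1).                                            *)
Definition orientation_preserving a : bool :=
  let s := image_seq a in
  count (fun p : 'I_n * 'I_n => p.2 < p.1) (zip s (rot 1 s)) <= 1.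
Definition orientation_reversing a : bool :=
  let s := image_seq a in
  count (fun p : 'I_n * 'I_n => p.1 < p.2) (zip s (rot 1 s)) <= 1.

Definition POR : {set PT n} :=
  [set a | orientation_preserving a || orientation_reversing a].
Definition OR : {set PT n} := [set a in POR | pt_dom a == [set: 'I_n]].
Definition PORI : {set PT n} := [set a in POR | dinjectiveb a (pt_dom a)].

Definition pt_of_perm (s : 'S_n) : PT n := [ffun i => Some (s i)].

(* The cycle (1 2 ... n) sends i to i + 1 mod n; gamma_n is rev_ord. *)
Definition dihedral : {group 'S_n} :=
  <<[set perm (@ordS_inj n); perm (@rev_ord_inj n)]>>%G.

(* The copy in POR of a subgroup of the symmetric group. *)
Definition pt_group (G : {group 'S_n}) : {set PT n} := pt_of_perm @: G.

End PartialTransformations.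

Arguments POR n : clear implicits.
Arguments OR n : clear implicits.
Arguments PORI n : clear implicits.
Arguments dihedral n : clear implicits.

(* Main.v *)
Require Import Defs.
From mathcomp Require Import all_boot all_fingroup gseries cyclic maximal.

(** Write S for POR n, D for its group of units and J for the set of elements
    of rank n - 1 of S.

    A sequence has at most one cyclic descent iff some rotation of it is
    sorted ([cyc_descP]), so the orientation-preserving maps are the products
    of a power of the rotation r by a partial map that is monotone for the
    usual order ([op_decomp]); the orientation-reversing ones are obtained by
    composing these with the reflection gamma. It follows that S is closed
    under composition and that its elements of rank n are exactly those of D.

    The elements of J are either total, or injective with a domain of size
    n - 1. Multiplying an element of J by suitable units gives an element one
    of whose powers is an idempotent of J ([rank_pred_struct]): a partial
    identity of rank n - 1 in the injective case, and a map collapsing two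
    adjacent points in the total case. Hence J is a regular J-class. The
    conjugates of these two kinds of idempotents generate, with D, all of S
    ([POR_sub]): a monotone partial map is a partial identity followed by a
    monotone total map, and the latter is a product of collapsing idempotents
    by induction on the total displacement of its points. So a subsemigroup
    that contains D, a total element of J and an injective one is equal to S
    ([POR_gen]).

    A maximal subsemigroup that does not contain D is therefore obtained from
    S by replacing D with a maximal subgroup, because S minus D is an ideal;
    one that contains D omits all the total elements of J or all the injective
    ones, and omitting exactly one of these two sets leaves a subsemigroup
    ([rank_pred_prime]).

    For n >= 3 the maximal subgroups of D are the group of rotations and, for
    each prime p dividing n, the p groups generated by r ^ p and a reflection
    r ^ j gamma with j < p ([maximal_dihedral], [dih_sub_inj]). For n = 2, D
    has order 2; the two elements of POR 1 are examined directly. *)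

Set Implicit Arguments.
Unset Strict Implicit.
Unset Printing Implicit Defensive.

Local Notation "a ** b" := (pt_mul a b) (at level 40, left associativity).
Local Notation pp := pt_of_perm.
Local Notation op := (@orientation_preserving _).

(** * Cyclic descents of sequences *)

Section CyclicDescents.

Variables (T : Type) (lt : rel T).

(** The number of cyclically consecutive pairs (x, y) in s such that y < x. *)
Definition cyc_desc (s : seq T) : nat :=
  count (fun p => lt p.2 p.1) (zip s (rot 1 s)).

Lemma zip_rot k (s t : seq T) : size s = size t ->
  zip (rot k s) (rot k t) = rot k (zip s t).
Proof.
move=> e; rewrite /rot zip_cat ?size_drop ?e //.
congr (_ ++ _); elim: k s t e => [|k IH] [|x s] [|y t] //= [e]; last by rewrite IH.
exact: IH.
Qed.

Lemma cyc_desc_rot k s : cyc_desc (rot k s) = cyc_desc s.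
Proof.
rewrite /cyc_desc rot_rot zip_rot ?size_rot //.
by rewrite /rot count_cat addnC -count_cat cat_take_drop.
Qed.

Lemma cyc_desc_cons x w :
  cyc_desc (x :: w) =
    count (fun p => lt p.2 p.1) (zip (x :: w) w) + lt x (last x w).
Proof.
rewrite /cyc_desc rot1_cons; move: {2 4}x => y.
elim: w x => [|z w IH] x /=; first by rewrite addn0.
by rewrite IH /= addnA.
Qed.

Lemma path_desc x w :
  path (fun a b => ~~ lt b a) x w =
    (count (fun p => lt p.2 p.1) (zip (x :: w) w) == 0).
Proof. by elim: w x => //= z w IH x; rewrite IH; case: lt. Qed.

Lemma cyc_descP s :
  reflect (exists k, sorted (fun a b => ~~ lt b a) (rot k s)) (cyc_desc s <= 1).
Proof.
apply: (iffP idP) => [|[k]]; last first.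
  rewrite -(cyc_desc_rot k); case: (rot k s) => //= x w.
  by rewrite cyc_desc_cons path_desc => /eqP->; case: lt.
case: (boolP (sorted (fun a b => ~~ lt b a) s)) => [|ns].
  by exists 0; rewrite rot0.
(* rotating a descent to the wrap-around position leaves no other descent *)
have [s1 [a [b [s2 [-> lt_ba]]]]] :
    exists s1 a b s2, s = rcons s1 a ++ b :: s2 /\ lt b a.
  case: s ns => //= x w; elim: w x => //= y w IH x.
  case: (boolP (lt y x)) => [lt_yx _|_ /= /IH].
    by exists [::], x, y, w.
  by case=> s1 [a [b [s2 [-> H]]]]; exists (x :: s1), a, b, s2.
rewrite -(cyc_desc_rot (size (rcons s1 a))) => H.
exists (size (rcons s1 a)); move: H; rewrite rot_size_cat /= cyc_desc_cons.
by rewrite last_cat last_rcons lt_ba addn1 ltnS leqn0 path_desc.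
Qed.

End CyclicDescents.

Lemma cyc_desc_map (T T' : Type) (lt : rel T) (lt' : rel T') (f : T -> T') s :
  (forall x y, lt' (f x) (f y) = lt x y) ->
  cyc_desc lt' (map f s) = cyc_desc lt s.
Proof.
move=> H; rewrite /cyc_desc -map_rot; move: (rot 1 s) => t.
by elim: s t => [|x s IH] [|y t] //=; rewrite IH H.
Qed.

Lemma pmap_eq_cat (aT rT : Type) (f : aT -> option rT) u s1 s2 :
  pmap f u = s1 ++ s2 ->
  exists u1 u2, [/\ u = u1 ++ u2, pmap f u1 = s1 & pmap f u2 = s2].
Proof.
elim: u s1 => [|v u IH] [|x s1] //=.
- by move=> <-; exists [::], [::].
- by move=> <-; exists [::], (v :: u).
case Ev: (f v) => [y|] /=.
  by case=> <- /IH[u1 [u2 [-> <- <-]]]; exists (v :: u1), u2; rewrite /= Ev.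
by move=> /(IH (x :: s1))[u1 [u2 [-> <- <-]]]; exists (v :: u1), u2; rewrite /= Ev.
Qed.

(** * Orientation-preserving partial maps *)

Section Orientation.

Variable n : nat.
Implicit Types (a b : PT n) (i j : 'I_n) (s : seq 'I_n).

(** The cycle (1 2 ... n). *)
Definition rotp : 'S_n := perm (@ordS_inj n).
(** The reflection gamma_n. *)
Definition gam : 'S_n := perm (@rev_ord_inj n).

Local Notation cyc := (cyc_desc (fun i j : 'I_n => i < j)).

Lemma opE a : op a = (cyc (image_seq a) <= 1).
Proof. by []. Qed.

Lemma cycP s :
  reflect (exists k, sorted (fun i j : 'I_n => i <= j) (rot k s)) (cyc s <= 1).
Proof.
apply: (iffP (cyc_descP _ _)) => -[k H]; exists k; move: H;
  by rewrite (@eq_sorted _ _ (fun i j : 'I_n => i <= j)) // => i j; rewrite -leqNgt.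
Qed.

Lemma image_seqM a b : image_seq (a ** b) = pmap b (image_seq a).
Proof.
rewrite /image_seq; elim: (enum _) => //= i s IH.
by rewrite ffunE; case: (a i) => //= j; rewrite IH.
Qed.

Lemma ppE (g : 'S_n) i : pp g i = Some (g i).
Proof. by rewrite ffunE. Qed.

Lemma image_seq_pp (g : 'S_n) : image_seq (pp g) = map g (enum 'I_n).
Proof. by rewrite /image_seq; elim: (enum _) => //= i s ->; rewrite ppE. Qed.

Lemma image_seq_ppr a (g : 'S_n) : image_seq (a ** pp g) = map g (image_seq a).
Proof. by rewrite image_seqM; elim: (image_seq a) => //= i s ->; rewrite ppE. Qed.

Lemma ppM (g h : 'S_n) : pp (g * h)%g = pp g ** pp h.
Proof. by apply/ffunP=> i; rewrite !ffunE /= ffunE permM. Qed.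

Lemma pp1 : pp (1%g : 'S_n) = pt_one n.
Proof. by apply/ffunP=> i; rewrite !ffunE perm1. Qed.

Lemma pp_inj : injective (@pp n).
Proof.
by move=> g h /ffunP e; apply/permP=> i; have := e i; rewrite !ppE; case.
Qed.

Lemma ppVK (g : 'S_n) : pp g^-1%g ** pp g = pt_one n.
Proof. by rewrite -ppM mulVg pp1. Qed.

Lemma ppKV (g : 'S_n) : pp g ** pp g^-1%g = pt_one n.
Proof. by rewrite -ppM mulgV pp1. Qed.

Lemma map_rotp : map rotp (enum 'I_n) = rot 1 (enum 'I_n).
Proof.
rewrite /rotp; case: n => [|m]; first by rewrite enum_ord0.
rewrite {2}enum_ordSl rot1_cons enum_ordSr map_rcons -map_comp.
congr rcons; last by apply/val_inj; rewrite /= permE /= modnn.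
apply: eq_map => i; apply/val_inj; rewrite /= permE /= modn_small //.
by rewrite ltnS.
Qed.

Lemma map_rotpX k : k <= n -> map (rotp ^+ k)%g (enum 'I_n) = rot k (enum 'I_n).
Proof.
elim: k => [|k IH] lekn.
  by rewrite rot0 map_id_in // => i _; rewrite perm1.
rewrite rotS ?size_enum_ord // -IH 1?ltnW // -map_rot -map_rotp -map_comp.
by apply: eq_map => i; rewrite expgS permM.
Qed.

Lemma rotpXE k i : (rotp ^+ k)%g i = (i + k) %% n :> nat.
Proof.
elim: k => [|k IH]; first by rewrite perm1 addn0 modn_small.
by rewrite expgSr permM permE /= IH addnS -[(_ %% n).+1]addn1 modnDml addn1.
Qed.

Lemma gamE i : gam i = rev_ord i. Proof. by rewrite permE. Qed.

Lemma gamK : (gam * gam)%g = 1%g.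
Proof. by apply/permP=> i; rewrite permM !gamE rev_ordK perm1. Qed.

(** A partial map is monotone when it preserves the usual order on its domain. *)
Definition mono a :=
  forall i j x y, a i = Some x -> a j = Some y -> i <= j -> x <= y.

Lemma leI_trans : transitive (fun i j : 'I_n => i <= j).
Proof. by move=> ? ? ?; apply: leq_trans. Qed.

Lemma mono_sorted a s : mono a -> sorted (fun i j : 'I_n => i <= j) s ->
  sorted (fun i j : 'I_n => i <= j) (pmap a s).
Proof.
move=> ma; rewrite !(sorted_pairwise leI_trans); elim: s => //= i s IH /andP[le_is /IH].
case Ei: (a i) => [x|] //= ->; rewrite andbT; apply/allP=> y.
rewrite mem_pmap => /mapP[j /(allP le_is) le_ij Ej]; exact: ma le_ij.
Qed.

Lemma monoP a : mono a <-> sorted (fun i j : 'I_n => i <= j) (image_seq a).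
Proof.
have sE : sorted (fun i j : 'I_n => i < j) (enum 'I_n).
  rewrite -[sorted _ _]/(sorted (relpre val ltn) _).
  by rewrite -sorted_map val_enum_ord iota_ltn_sorted.
split=> [ma|].
  apply: mono_sorted => //; apply: sub_sorted sE => i j; exact: ltnW.
have lt_tr : transitive (fun i j : 'I_n => i < j) by move=> ? ? ?; apply: ltn_trans.
rewrite /image_seq (sorted_pairwise leI_trans) => H i j x y.
move: (mem_enum 'I_n i) (mem_enum 'I_n j) => /=.
move: sE; rewrite (sorted_pairwise lt_tr).
elim: (enum 'I_n) H => [//|k s IH] H /= /andP[lt_ks ps].
rewrite !inE; case: eqP => [-> _|_ /= si]; case: eqP => [-> _|_ /= sj].
- by move=> -> [->].
- move=> Ei Ej _; move: H => /=; rewrite Ei /= => /andP[/allP H _].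
  by apply: H; rewrite mem_pmap; apply/mapP; exists j.
- by move=> _ _; rewrite leqNgt (allP lt_ks).
- by apply: IH => //; move: H => /=; case: (a k) => [z|] //= /andP[].
Qed.

Lemma op_rotl a : op (pp rotp ** a) = op a.
Proof.
rewrite !opE image_seqM image_seq_pp map_rotp /rot pmap_cat.
by rewrite -rot_size_cat cyc_desc_rot -pmap_cat cat_take_drop.
Qed.

Lemma op_rotXl k a : op (pp (rotp ^+ k)%g ** a) = op a.
Proof.
elim: k => [|k IH]; first by rewrite pp1 pt_mul1r.
by rewrite expgS ppM -pt_mulA op_rotl.
Qed.

Lemma mono_op a : mono a -> op a.
Proof. by move=> /monoP ma; rewrite opE; apply/cycP; exists 0; rewrite rot0. Qed.

Lemma opP a : op a <-> exists k, mono (pp (rotp ^+ k)%g ** a).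
Proof.
split=> [|[k /mono_op]]; last by rewrite op_rotXl.
rewrite opE => /cycP[k]; rewrite {1}/rot.
have /pmap_eq_cat[u1 [u2 [Eu Eu1 Eu2]]] :
  image_seq a = take k (image_seq a) ++ drop k (image_seq a).
  by rewrite cat_take_drop.
rewrite -Eu1 -Eu2 -pmap_cat -rot_size_cat -Eu -map_rotpX; last first.
  by have E := size_enum_ord n; rewrite Eu size_cat in E; rewrite -[X in _ <= X]E leq_addr.
by exists (size u1); apply/monoP; rewrite image_seqM image_seq_pp.
Qed.

Lemma rotp_n : (rotp ^+ n)%g = 1%g.
Proof.
by apply/permP=> i; apply/val_inj; rewrite /= rotpXE perm1 modnDr modn_small.
Qed.

Lemma cyc_map_rotp s : cyc s <= 1 -> cyc (map rotp s) <= 1.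
Proof.
move=> /cycP[k]; rewrite -(cyc_desc_rot _ k) -map_rot.
move: (rot k s) => {k} {}s.
(* m = n - 1; in a sorted sequence, the entries equal to m, which are sent to 0,
   form a final block s2 *)
have [m Em] : exists m, forall i : 'I_n,
    (rotp i = (if i < m then i.+1 else 0) :> nat) /\ (~~ (i < m) -> i = m :> nat).
  exists n.-1 => i; have n_gt0 : 0 < n by case: (n) i => // -[].
  rewrite /rotp permE /=; case: ltnP => [lt|le].
    by rewrite modn_small // -ltn_predRL.
  have -> : i = n.-1 :> nat by apply/eqP; rewrite eqn_leq le -ltnS prednK // ltn_ord.
  by rewrite prednK // modnn.
rewrite (sorted_pairwise leI_trans) => ss.
have [s1 [s2 [Es a1 a2]]] : exists s1 s2,
    [/\ s = s1 ++ s2, {in s1, forall i, i < m} & {in s2, forall i, ~~ (i < m)}].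
  elim: s ss => [|i s IH] /=; first by exists [::], [::].
  case/andP=> /allP le_i /IH[s1 [s2 [Es a1 a2]]].
  case: (boolP (i < m)) => [lt_im|ge_im].
    exists (i :: s1), s2; rewrite Es; split=> // j; rewrite inE => /predU1P[->//|].
    exact: a1.
  exists [::], (i :: s); split=> // j; rewrite inE => /predU1P[->//|/le_i le_ij].
  by rewrite -leqNgt (leq_trans _ le_ij) // leqNgt.
move: ss; rewrite {}Es pairwise_cat => /and3P[_ p1 _].
apply/cycP; exists (size s1); rewrite map_cat -(size_map rotp) rot_size_cat.
have E0 j : j \in s2 -> rotp j = 0 :> nat by move=> /a2 H; rewrite (Em j).1 (negPf H).
rewrite (sorted_pairwise leI_trans) pairwise_cat; apply/and3P; split.
- by apply/allrelP=> _ y /mapP[j js ->] _; rewrite E0.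
- rewrite pairwise_map; elim: (s2) E0 => //= j t IH E0; rewrite IH ?andbT.
    by apply/allP=> k _ /=; rewrite E0 ?mem_head.
  by move=> k ks; apply: E0; rewrite inE ks orbT.
rewrite pairwise_map; elim: (s1) p1 a1 => //= j t IH /andP[/allP all_j ps] a1.
rewrite IH // ?andbT; last by move=> k ks; apply: a1; rewrite inE ks orbT.
apply/allP=> k ks /=; rewrite !(Em _).1 !a1 ?mem_head ?inE ?ks ?orbT //.
exact: all_j.
Qed.

Lemma op_rotr a : op a -> op (a ** pp rotp).
Proof. by rewrite !opE image_seq_ppr; apply: cyc_map_rotp. Qed.

Lemma op_rotXr k a : op a -> op (a ** pp (rotp ^+ k)%g).
Proof.
elim: k => [|k IH] oa; first by rewrite pp1 pt_mulr1.
by rewrite expgSr ppM pt_mulA op_rotr ?IH.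
Qed.

Lemma rotpVX k : exists m, ((rotp ^+ k)^-1 = rotp ^+ m)%g.
Proof.
exists (#[rotp]%g * k - k); rewrite -expgVn; apply/eqP.
rewrite eq_sym -(inj_eq (mulIg (rotp ^+ k)%g)) -expgD subnK ?leq_pmull ?order_gt0 //.
by rewrite expgM expg_order expg1n expgVn mulVg.
Qed.

Lemma op_decomp a : op a -> exists k b, mono b /\ a = pp (rotp ^+ k)%g ** b.
Proof.
move=> /opP[k mb]; have [m Em] := rotpVX k.
by exists m, (pp (rotp ^+ k)%g ** a); rewrite -Em pt_mulA ppVK pt_mul1r.
Qed.

(** With b = r ^ k c and c monotone, a r ^ k is still orientation-preserving, and
    c maps a sorted rotation of its image sequence to a sorted sequence. *)
Lemma op_mul a b : op a -> op b -> op (a ** b).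
Proof.
move=> oa /op_decomp[k [c [mc ->]]]; rewrite pt_mulA.
move: (op_rotXr k oa); move: (a ** _) => {oa}a.
rewrite !opE image_seqM => /cycP[l sl].
have := mono_sorted mc sl; rewrite /rot pmap_cat -rot_size_cat -pmap_cat cat_take_drop.
by move=> H; apply/cycP; eexists; exact: H.
Qed.

Local Notation orv := (@orientation_reversing n).

Lemma orvE a : orv a = op (a ** pp gam).
Proof.
rewrite opE image_seq_ppr /orv -[RHS]/(cyc_desc _ _ <= 1).
rewrite (cyc_desc_map (lt := fun i j : 'I_n => j < i)) // => x y.
by rewrite !gamE /= ltn_sub2lE // ltnS.
Qed.

(** Conjugation by gamma reverses the image sequence and the order of its values. *)
Lemma op_conj_gam a : op a -> op (pp gam ** a ** pp gam).
Proof.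
have revE : map gam (enum 'I_n) = rev (enum 'I_n).
  apply: (inj_map val_inj); rewrite map_rev val_enum_ord -map_comp.
  apply: (@eq_from_nth _ 0); first by rewrite size_rev size_map size_iota size_enum_ord.
  move=> i; rewrite size_map size_enum_ord => lt_in.
  rewrite nth_rev ?size_iota // (nth_map (Ordinal lt_in)) ?size_enum_ord //=.
  by rewrite gamE /= nth_enum_ord // nth_iota // ltn_subrL (leq_trans _ lt_in).
rewrite !opE image_seq_ppr image_seqM image_seq_pp revE => /cycP[k sk].
have -> : pmap a (rev (enum 'I_n)) = rev (image_seq a).
  rewrite /image_seq; elim: (enum _) => //= i s IH; rewrite rev_cons -cats1 pmap_cat IH /=.
  by case: (a i) => [x|] /=; rewrite ?rev_cons ?cats1 ?cats0.
apply/cycP; rewrite -(rotK k (image_seq a)) rev_rotr map_rot.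
move: (rot k _) sk => s ss; exists (size s - k).
rewrite -[size s](size_rev s) -(size_map gam) -(size_rot k) -/(rotr k _) rotK.
rewrite sorted_map rev_sorted; apply: sub_sorted ss => i j /= le_ij.
by rewrite !gamE /= leq_sub2l // ltnS.
Qed.

Lemma PORE a : (a \in POR n) = op a || op (a ** pp gam).
Proof. by rewrite inE orvE. Qed.

Lemma gamgam a : a ** pp gam ** pp gam = a.
Proof. by rewrite -pt_mulA -ppM gamK pp1 pt_mulr1. Qed.

Lemma PORP a :
  reflect (op a \/ exists2 b, op b & a = b ** pp gam) (a \in POR n).
Proof.
rewrite PORE; apply: (iffP orP) => -[oa|]; try by left.
  by move=> oa; right; exists (a ** pp gam); rewrite ?gamgam.
by case=> b ob ->; right; rewrite gamgam.
Qed.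

Lemma op_POR a : op a -> a \in POR n.
Proof. by move=> oa; apply/PORP; left. Qed.

Lemma POR_gam a : op a -> a ** pp gam \in POR n.
Proof. by move=> oa; apply/PORP; right; exists a. Qed.

Lemma POR_mul a b : a \in POR n -> b \in POR n -> a ** b \in POR n.
Proof.
have swap c : op c -> exists2 d, op d & pp gam ** c = d ** pp gam.
  move=> oc; exists (pp gam ** c ** pp gam); first exact: op_conj_gam.
  by rewrite gamgam.
case/PORP=> [oa|[{}a oa ->]] /PORP[ob|[{}b ob ->]].
- by apply: op_POR; apply: op_mul.
- by rewrite pt_mulA; apply/POR_gam/op_mul.
- have [d od E] := swap b ob; rewrite -pt_mulA E pt_mulA.
  by apply/POR_gam/op_mul.
- have [d od E] := swap b ob; rewrite -pt_mulA (pt_mulA (pp gam)) E gamgam.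
  by apply/op_POR/op_mul.
Qed.

End Orientation.

(** * Rank and units *)

Section Rank.

Variable n : nat.
Implicit Types (a b : PT n) (i j : 'I_n).

Lemma pt_mulE a b i : (a ** b) i = obind b (a i).
Proof. by rewrite ffunE. Qed.

Lemma pt_imP a j : reflect (exists i, a i = Some j) (j \in pt_im a).
Proof. by rewrite inE; apply: (iffP existsP) => -[i Ei]; exists i; apply/eqP. Qed.

Lemma Some_pt_im a : [set Some j | j in pt_im a] = a @: pt_dom a.
Proof.
apply/setP=> o; apply/imsetP/imsetP=> [[j /pt_imP[i Ei] ->]|[i]].
  by exists i; rewrite ?inE ?Ei.
by rewrite inE; case Ei: (a i) => [j|] // _ ->; exists j => //; apply/pt_imP; exists i.
Qed.

Lemma card_pt_dom a : #|a @: pt_dom a| = pt_rank a.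
Proof. by rewrite -Some_pt_im card_imset //; apply: Some_inj. Qed.

Lemma pt_rank_dom a : pt_rank a <= #|pt_dom a|.
Proof. by rewrite -card_pt_dom leq_imset_card. Qed.

Lemma pt_rankMr a b : pt_rank (a ** b) <= pt_rank b.
Proof.
apply/subset_leq_card/subsetP=> j /pt_imP[i]; rewrite pt_mulE.
by case: (a i) => //= k Ek; apply/pt_imP; exists k.
Qed.

Lemma pt_rankMl a b : pt_rank (a ** b) <= pt_rank a.
Proof.
rewrite -card_pt_dom -[leqRHS]card_pt_dom.
have /subset_leq_card : (a ** b) @: pt_dom (a ** b) \subset
    (obind b) @: [set Some j | j in pt_im a].
  apply/subsetP=> o /imsetP[i]; rewrite inE pt_mulE; case Ei: (a i) => [k|] //= _ ->.
  by apply/imsetP; exists (Some k) => //; apply/imset_f/pt_imP; exists i.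
move/leq_trans; apply; rewrite Some_pt_im; exact: leq_imset_card.
Qed.

Lemma pt_ppKl (g : 'S_n) a : pp g^-1%g ** (pp g ** a) = a.
Proof. by rewrite pt_mulA ppVK pt_mul1r. Qed.

Lemma pt_ppKr (g : 'S_n) a : a ** pp g ** pp g^-1%g = a.
Proof. by rewrite -pt_mulA ppKV pt_mulr1. Qed.

Lemma pt_rank_ppl (g : 'S_n) a : pt_rank (pp g ** a) = pt_rank a.
Proof.
by apply/eqP; rewrite eqn_leq pt_rankMr -{1}[a](pt_ppKl g) pt_rankMr.
Qed.

Lemma pt_rank_ppr (g : 'S_n) a : pt_rank (a ** pp g) = pt_rank a.
Proof.
by apply/eqP; rewrite eqn_leq pt_rankMl -{1}[a](pt_ppKr g) pt_rankMl.
Qed.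

Lemma pt_rank_pp (g : 'S_n) : pt_rank (pp g) = n.
Proof.
rewrite -[RHS]card_ord -cardsT; congr #|pred_of_set _|; apply/setP=> j; rewrite in_setT.
by apply/pt_imP; exists (g^-1%g j); rewrite ppE permKV.
Qed.

Lemma pt_rank_le a : pt_rank a <= n.
Proof. by rewrite -[leqRHS]card_ord max_card. Qed.

Lemma pt_dom_total a : #|pt_dom a| = n -> pt_dom a = setT.
Proof. by move=> E; apply/eqP; rewrite eqEcard subsetT cardsT card_ord E leqnn. Qed.

Lemma pt_dom_setT a i : pt_dom a = setT -> exists j, a i = Some j.
Proof.
by move/setP/(_ i); rewrite in_setT inE; case: (a i) => [j|] //; exists j.
Qed.

Lemma pt_injP a :
  reflect {in pt_dom a &, injective a} (pt_rank a == #|pt_dom a|).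
Proof. by rewrite -card_pt_dom; apply: imset_injP. Qed.

Lemma pt_rank_n a : pt_rank a = n -> exists g, a = pp g.
Proof.
move=> Ea; have Ed : #|pt_dom a| = n.
  apply/eqP; rewrite eqn_leq; have := pt_rank_dom a; rewrite Ea => ->; rewrite andbT.
  by have := max_card (mem (pt_dom a)); rewrite card_ord.
have aT := pt_dom_total Ed.
have /pt_injP inj_a : pt_rank a == #|pt_dom a| by rewrite Ed Ea.
have inj_g : injective (fun i => odflt i (a i)).
  move=> i j; have [x Ex] := pt_dom_setT i aT; have [y Ey] := pt_dom_setT j aT.
  rewrite Ex Ey /= => Exy; apply: inj_a; rewrite ?aT ?in_setT //.
  by rewrite Ex Ey Exy.
exists (perm inj_g); apply/ffunP=> i; rewrite ppE permE.
by have [x ->] := pt_dom_setT i aT.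
Qed.

Lemma mono_perm (g : 'S_n) : mono (pp g) -> g = 1%g.
Proof.
move=> /monoP; rewrite image_seq_pp => sg.
have E : map g (enum 'I_n) = enum 'I_n.
  apply: (sorted_eq (@leI_trans n)) => //.
  - by move=> i j /= ij; apply/val_inj/eqP; rewrite eqn_leq.
  - have /monoP : mono (pt_one n) by move=> i j x y; rewrite !ffunE => -[<-] [<-].
    by rewrite -pp1 image_seq_pp map_id_in // => i _; rewrite perm1.
  apply: uniq_perm; rewrite ?(map_inj_uniq perm_inj) ?enum_uniq // => i.
  rewrite mem_enum; apply/mapP; exists (g^-1%g i); rewrite ?mem_enum //.
  by rewrite permKV.
apply/permP=> i; rewrite perm1.
have /eq_in_map/(_ i) : map g (enum 'I_n) = map id (enum 'I_n) by rewrite map_id.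
by apply; rewrite mem_enum.
Qed.

Lemma rotp_dihedral : rotp n \in dihedral n.
Proof. by apply: mem_gen; rewrite !inE eqxx. Qed.

Lemma gam_dihedral : gam n \in dihedral n.
Proof. by apply: mem_gen; rewrite !inE eqxx orbT. Qed.

Lemma rotpX_dihedral k : (rotp n ^+ k)%g \in dihedral n.
Proof. by rewrite groupX ?rotp_dihedral. Qed.

Lemma one_op : op (pt_one n).
Proof. by apply: mono_op => i j x y; rewrite !ffunE => -[<-] [<-]. Qed.

Lemma dihedral_POR g : g \in dihedral n -> pp g \in POR n.
Proof.
have gS : group_set [set g | pp g \in POR n].
  apply/group_setP; rewrite inE pp1 op_POR ?one_op //; split=> // x y.
  by do 2!(rewrite inE => ?); rewrite inE ppM; apply: POR_mul.
suff /subsetP H : dihedral n \subset group gS by move/H; rewrite inE.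
rewrite gen_subG; apply/subsetP=> x; rewrite in_set2 => /orP[]/eqP->; rewrite inE.
  by rewrite -[pp _]pt_mulr1; apply: op_POR; rewrite op_rotl one_op.
by rewrite -[pp _]pt_mul1r POR_gam ?one_op.
Qed.

(** The elements of rank n of POR n are the elements of the dihedral group. *)
Lemma POR_rank_n a : a \in POR n -> pt_rank a = n ->
  exists2 g, g \in dihedral n & a = pp g.
Proof.
have key b : op b -> pt_rank b = n -> exists2 g, g \in dihedral n & b = pp g.
  case/op_decomp=> k [c [mc ->]]; rewrite pt_rank_ppl => /pt_rank_n[g Eg].
  move: mc; rewrite {}Eg => /mono_perm->; exists (rotp n ^+ k)%g.
    exact: rotpX_dihedral.
  by rewrite -ppM mulg1.
case/PORP=> [|[b ob ->]]; first exact: key.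
rewrite pt_rank_ppr => /(key _ ob)[g gD ->].
by exists (g * gam n)%g; rewrite ?groupM ?gam_dihedral ?ppM.
Qed.

Lemma rotp_trans i j : exists k, (rotp n ^+ k)%g i = j.
Proof.
exists (j + n - i); apply/val_inj; rewrite /= rotpXE subnKC ?modnDr ?modn_small //.
by rewrite ltnW // ltn_addl.
Qed.

(** * The elements of rank n - 1 *)

(** The partial identity undefined only at i. *)
Definition eid i : PT n := [ffun k => if k == i then None else Some k].

(** The idempotent sending i to j and fixing every other point. *)
Definition col i j : PT n := [ffun k => Some (if k == i then j else k)].

Lemma eid_conj (g : 'S_n) i : pp g^-1%g ** eid i ** pp g = eid (g i).
Proof.
apply/ffunP=> k; rewrite !ffunE /= !ffunE.
by rewrite -(inj_eq (@perm_inj _ g)) permKV; case: eqP => //= _; rewrite ppE permKV.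
Qed.

Lemma col_conj (g : 'S_n) i j : pp g^-1%g ** col i j ** pp g = col (g i) (g j).
Proof.
apply/ffunP=> k; rewrite !ffunE /= !ffunE /= ppE.
by rewrite -(inj_eq (@perm_inj _ g)) permKV; case: eqP => //= _; rewrite permKV.
Qed.

Definition pt_closed (M : {set PT n}) :=
  forall a b, a \in M -> b \in M -> a ** b \in M.

(** The idempotent f is a power of z and is an identity for z: f = w z, where w, a
    power of z that may be 1, lies in every submonoid containing z. *)
Definition group_idem z f := exists w, [/\ w ** z = f, f ** z = z, z ** f = z
  & forall M, pt_closed M -> pt_one n \in M -> z \in M -> w \in M].

(** As (f s)^k = f s^k whenever f s f = f s, the order of s gives the power of
    f s that equals f. *)
Lemma idem_power f (s : 'S_n) (z := f ** pp s) :
  f ** f = f -> z ** f = z -> group_idem z f.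
Proof.
move=> ff zf; have fz : f ** z = z by rewrite /z pt_mulA ff.
have zX k : iter k (pt_mul z) (pt_one n) ** z = f ** pp (s ^+ k.+1)%g.
  elim: k => [|k IH]; first by rewrite /= pt_mul1r.
  by rewrite iterS -pt_mulA IH pt_mulA zf /z -pt_mulA -ppM -expgS.
exists (iter #[s]%g.-1 (pt_mul z) (pt_one n)); split=> //.
  by rewrite zX prednK ?order_gt0 // expg_order pp1 pt_mulr1.
by move=> M cM M1 Mz; elim: _.-1 => //= k IH; apply: cM.
Qed.

(** Here z = f s, where the permutation s fixes i and agrees with z elsewhere. *)
Lemma rank_pred_power (z f : PT n) i :
  (forall k, k != i -> f k = Some k) -> f i != Some i ->
  z i = obind z (f i) ->
  (forall k, k != i -> exists2 x, z k = Some x & x != i) ->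
  {in [set~ i] &, injective z} -> group_idem z f.
Proof.
move=> fk fi zi zk inj_z.
have inj_s : injective (fun k => if k == i then i else odflt i (z k)).
  have H k : k != i -> odflt i (z k) != i by move/zk=> [x ->].
  move=> k l; case: eqP => [->|/eqP ki]; case: eqP => [->|/eqP li] // E.
  - by case/eqP: (H _ li).
  - by case/eqP: (H _ ki).
  have [x Ex _] := zk _ ki; have [y Ey _] := zk _ li; move: E; rewrite Ex Ey /= => E.
  by apply: inj_z; rewrite ?inE // Ex Ey E.
have Es k : k != i -> pp (perm inj_s) k = z k.
  by move=> ki; rewrite ppE permE (negPf ki); case: (zk k ki) => x ->.
have Ez : z = f ** pp (perm inj_s).
  apply/ffunP=> k; rewrite pt_mulE; case: (eqVneq k i) => [->|ki].
    by rewrite zi; case: (f i) fi => //= j ji; rewrite Es.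
  by rewrite fk //= Es.
have ff : f ** f = f.
  apply/ffunP=> k; rewrite pt_mulE; case: (eqVneq k i) => [->|ki].
    by case: (f i) fi => //= j ji; rewrite fk.
  by rewrite fk //= fk.
rewrite Ez; apply: idem_power => //; rewrite -Ez; apply/ffunP=> k; rewrite pt_mulE.
suff [->|[x -> xi]] : z k = None \/ exists2 x, z k = Some x & x != i by [|rewrite /= fk].
case: (eqVneq k i) => [->|/zk]; last by right.
by rewrite zi; case: (f i) fi => [j /= ji|]; [right; apply: zk|left].
Qed.

(** Multiplying an element a of rank n - 1 by suitable units gives an element
    with a power of the form eid i when a is not total (so a is injective),
    and of the form col (i + 1) i when a is total. *)
Lemma rank_pred_struct a : 0 < n -> a \in POR n -> pt_rank a = n.-1 ->
  exists g h f,
  [/\ g \in dihedral n, h \in dihedral n, group_idem (pp g ** a ** pp h) f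
    & (pt_dom a <> setT /\ exists i, f = eid i) \/
      (pt_dom a = setT /\ exists i j, j = i.+1 :> nat /\ f = col j i)].
Proof.
move=> n_gt0 Sa ra.
have miss b : pt_rank b = n.-1 -> exists j, forall i, b i <> Some j.
  move=> rb; have : ~~ ([set: 'I_n] \subset pt_im b).
    apply/negP=> /subset_leq_card; rewrite cardsT card_ord -/(pt_rank b) rb.
    by rewrite leqNgt prednK // leqnn.
  case/subsetPn=> j _ jb; exists j => i Ei; case/negP: jb; apply/pt_imP; by exists i.
have [aT|aT] := eqVneq (pt_dom a) setT; last first.
  have [i ia] : exists i, i \notin pt_dom a.
    apply/existsP; rewrite -negb_forall; apply: contra aT => /forallP H.
    by apply/eqP/setP=> i; rewrite H in_setT.
  have da : pt_dom a = [set~ i].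
    apply/eqP; rewrite eqEcard cardsC1 card_ord -ra pt_rank_dom andbT.
    by apply/subsetP=> k ka; rewrite !inE; apply: contraNneq ia => <-.
  (* rotating the image of a makes it avoid the point i missing from the domain *)
  have [j Hj] := miss a ra; have [k Ek] := rotp_trans j i.
  have Hf : group_idem (a ** pp (rotp n ^+ k)%g) (eid i).
    apply: (@rank_pred_power _ _ i).
    - by move=> l li; rewrite ffunE (negPf li).
    - by rewrite ffunE eqxx.
    - by rewrite pt_mulE ffunE eqxx; move: ia; rewrite inE negbK => /eqP->.
    - move=> l; rewrite pt_mulE => li.
      have : l \in pt_dom a by rewrite da !inE.
      rewrite inE; case El: (a l) => [x|] // _; rewrite /= ppE; eexists; first by [].
      by rewrite -Ek (inj_eq perm_inj); apply: contra_notN (Hj l) => /eqP <-.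
    have /pt_injP inj_a : pt_rank a == #|pt_dom a| by rewrite da cardsC1 card_ord ra.
    move=> x y; rewrite -da !pt_mulE => xa ya E; apply: inj_a => //; move: xa ya E.
    rewrite !inE; case: (a x) (a y) => [u|] // [v|] //= _ _.
    by rewrite !ppE => -[/perm_inj->].
  exists 1%g, (rotp n ^+ k)%g, (eid i); rewrite /= pp1 pt_mul1r group1 rotpX_dihedral.
  by split=> //; left; split; [apply/eqP|exists i].
have [g0 g0D [k [b [mb Eb]]]] : exists2 g0, g0 \in dihedral n & 
    exists k b, mono b /\ a ** pp g0 = pp (rotp n ^+ k)%g ** b.
  move: Sa; rewrite PORE => /orP[] /op_decomp H; last first.
    by exists (gam n) => //; exact: gam_dihedral.
  by exists 1%g; rewrite ?group1 // pp1 pt_mulr1.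
have rb : pt_rank b = n.-1 by rewrite -(pt_rank_ppl (rotp n ^+ k)%g) -Eb pt_rank_ppr.
have Eb' : b = pp (rotp n ^+ k)^-1%g ** a ** pp g0 by rewrite -pt_mulA Eb pt_ppKl.
have bk l : exists x, b l = Some x.
  rewrite Eb' pt_mulE pt_mulE ppE /=.
  have [x ->] := pt_dom_setT ((rotp n ^+ k)^-1%g l) aT; by rewrite /= ppE; eexists.
have bT : pt_dom b = setT by apply/setP=> l; rewrite in_setT inE; case: (bk l) => x ->.
(* b is monotone and not injective, so it identifies two adjacent points *)
have [i [j [Ej Eij]]] : exists i j : 'I_n, j = i.+1 :> nat /\ b i = b j.
  have : ~~ dinjectiveb b (pt_dom b).
    apply/dinjectiveP=> /pt_injP; rewrite rb bT cardsT card_ord.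
    by rewrite -{2}(prednK n_gt0) eqn_leq ltnn andbF.
  case/dinjectivePn=> i _ [j]; rewrite inE => /andP[ji _].
  wlog ij : i j ji / i < j => [IH|] Eij.
    case: (ltngtP i j) => [/IH|/IH|/val_inj E]; [apply|rewrite eq_sym; apply|] => //.
    by rewrite E eqxx in ji.
  have i1n : i.+1 < n by apply: leq_ltn_trans ij _; apply: ltn_ord.
  exists i, (Ordinal i1n); split=> //.
  have [x Ex] := bk i; have [y Ey] := bk (Ordinal i1n); have Ex' := Ex; rewrite Eij in Ex'.
  rewrite Ex Ey; congr Some; apply/val_inj/eqP; rewrite eqn_leq.
  by rewrite (mb _ _ _ _ Ex Ey) //= (mb _ _ _ _ Ey Ex').
(* rotating the image of b makes it avoid j, so that col j i fixes it pointwise *)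
have [m Hm] := miss b rb; have [l El] := rotp_trans m j.
have ij : i != j by rewrite -(inj_eq val_inj) /= Ej neq_ltn ltnSn.
pose h := (g0 * rotp n ^+ l)%g; pose z := b ** pp (rotp n ^+ l)%g.
have Ez : z = pp (rotp n ^+ k)^-1%g ** a ** pp h by rewrite /z Eb' ppM !pt_mulA.
have zk x : exists2 y, z x = Some y & y != j.
  have [y Ey] := bk x; rewrite /z pt_mulE Ey /= ppE; eexists; first by [].
  by rewrite -El (inj_eq perm_inj); apply: contra_notN (Hm x) => /eqP <-.
have zij : z i = z j by rewrite /z !pt_mulE Eij.
have Hf : group_idem z (col j i).
  apply: (@rank_pred_power _ _ j).
  - by move=> x xj; rewrite ffunE (negPf xj).
  - by rewrite ffunE eqxx (inj_eq Some_inj).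
  - by rewrite [col j i j]ffunE eqxx /= zij.
  - by move=> x _; apply: zk.
  apply/imset_injP; rewrite cardsC1 card_ord -rb -(pt_rank_ppr (rotp n ^+ l)%g) -/z.
  rewrite -card_pt_dom; apply/eqP; congr #|pred_of_set _|; apply/eqP; rewrite eqEsubset.
  apply/andP; split; apply/subsetP=> o /imsetP[x xP ->].
    by apply: imset_f; rewrite inE; case: (zk x) => y ->.
  have [->|xj] := eqVneq x j; first by rewrite -zij imset_f // !inE.
  by rewrite imset_f // !inE.
exists (rotp n ^+ k)^-1%g, h, (col j i); rewrite /= -Ez groupV rotpX_dihedral.
by rewrite groupM ?rotpX_dihedral //; split=> //; right; split=> //; exists i, j.
Qed.

End Rank.

(** * Generating POR n *)

Section Generation.

Variable n : nat.
Implicit Types (a b : PT n) (i j k : 'I_n) (f : 'I_n -> 'I_n) (A : {set 'I_n}).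

(** The transformation given by a function. *)
Definition tot f : PT n := [ffun i => Some (f i)].

(** The total displacement of f. *)
Definition disp f : nat := \sum_i ((f i - i) + (i - f i)).

(** Let i be the last point with i < f i; then f (i + 1) = f i = i + 1. Let k be the
    first point with f k = i + 1: changing the value of f at k to i brings it closer
    to k, and f is recovered by first sending k to k + 1. *)
Lemma mono_total_step f : {homo f : i j / i <= j} -> (exists i, i < f i) ->
  exists i j f', [/\ j = i.+1 :> nat, {homo f' : i j / i <= j},
    disp f' < disp f & tot f = col i j ** tot f'].
Proof.
move=> mf [i0 i0f].
case: (@arg_maxnP _ i0 (fun i => i < f i) val i0f) => i if_ max_i.
have j_lt : i.+1 < n by apply: leq_ltn_trans if_ (ltn_ord _).
pose j := Ordinal j_lt; have ij : i <= j by exact: leqnSn.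
have fj_le : f j <= j.
  by rewrite leqNgt; apply/negP=> /max_i /=; rewrite ltnn.
have fij := mf _ _ ij.
have fj : f j = j by apply/val_inj/eqP; rewrite eqn_leq fj_le (leq_trans if_ fij).
have fi : f i = j by apply/val_inj/eqP; rewrite fj in fij; rewrite eqn_leq if_ andbT.
have P0 : f i == j by apply/eqP.
case: (@arg_minnP _ i (fun k => f k == j) val P0) => k /eqP fk min_k.
have ki : k <= i by exact: min_k.
have k1_lt : k.+1 < n by rewrite (leq_ltn_trans _ (ltn_ord j)).
pose k1 := Ordinal k1_lt.
have kk1 : k1 != k by rewrite -(inj_eq val_inj) /= neq_ltn ltnSn orbT.
have fk1 : f k1 = j.
  have l1 : f k1 <= f j by rewrite mf //= ltnS.
  have l2 : f k <= f k1 by rewrite mf /=.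
  by apply/val_inj/eqP; rewrite fj in l1; rewrite fk in l2; rewrite eqn_leq l1.
pose f' l := if l == k then i else f l.
exists k, k1, f'; split=> //.
- move=> l l' ll'; rewrite /f'; case: eqP => [El|/eqP lk]; case: eqP => [El'|/eqP lk'] //.
  - by apply: leq_trans ij _; rewrite -fk mf // -El.
  - subst l'; have : f l <= j by rewrite -fk mf.
  rewrite leq_eqVlt => /orP[/eqP E|]; last by rewrite ltnS.
    have /min_k : f l == j by apply/eqP/val_inj.
    by move=> kl; case/eqP: lk; apply/val_inj/eqP; rewrite eqn_leq ll'.
  - exact: mf.
- have E h : disp h = h k - k + (k - h k) + \sum_(l | l != k) (h l - l + (l - h l)).
    by rewrite /disp (bigD1 k).
  rewrite !E.
  have -> : \sum_(l | l != k) (f' l - l + (l - f' l)) =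
      \sum_(l | l != k) (f l - l + (l - f l)).
    by apply: eq_bigr => l lk; rewrite /f' (negPf lk).
  rewrite ltn_add2r /f' eqxx fk.
  have /eqP-> : k - i == 0 by rewrite subn_eq0.
  by rewrite addn0; apply: leq_trans (leq_addr _ _); rewrite /= subSn.
- apply/ffunP=> l; rewrite pt_mulE !ffunE /= ffunE /f'.
  by case: (eqVneq l k) => [->|lk]; [rewrite (negPf kk1) fk fk1|rewrite (negPf lk)].
Qed.

Lemma tot_gam f : tot (fun i => gam n (f (gam n i))) = pp (gam n) ** tot f ** pp (gam n).
Proof. by apply/ffunP=> i; rewrite !pt_mulE ppE /= !ffunE /= ppE. Qed.

Lemma disp_gam f : disp (fun i => gam n (f (gam n i))) = disp f.
Proof.
rewrite /disp (reindex_inj (@perm_inj _ (gam n))) /=; apply: eq_bigr => i _.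
have sub_rev (x y : 'I_n) : rev_ord x - rev_ord y = y - x.
  by rewrite /= subnBA // addnBAC // subnAC addKn subSS.
by rewrite -permM gamK perm1 !gamE !sub_rev addnC.
Qed.

Section InSubsemigroup.

Variable M : {set PT n}.
Hypothesis closedM : pt_closed M.
Hypothesis unitsM : forall g, g \in dihedral n -> pp g \in M.

Let M1 : pt_one n \in M.
Proof. by rewrite -pp1 unitsM. Qed.

Lemma eid_all i0 : eid i0 \in M -> forall i, eid i \in M.
Proof.
move=> Mi0 i; have [k <-] := rotp_trans i0 i; rewrite -eid_conj.
by rewrite !(closedM, unitsM) ?groupV ?rotpX_dihedral.
Qed.

Lemma col_all i0 j0 : j0 = i0.+1 :> nat -> col j0 i0 \in M ->
  forall i j, j = i.+1 :> nat -> col i j \in M.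
Proof.
move=> E0 Mc i j E; have [k Ek] := rotp_trans (gam n j0) i.
pose h := (gam n * rotp n ^+ k)%g.
have hD : h \in dihedral n by rewrite groupM ?gam_dihedral ?rotpX_dihedral.
have <- : h j0 = i by rewrite permM.
have <- : h i0 = j.
  apply/val_inj; rewrite /= permM rotpXE.
  have -> : gam n i0 = (gam n j0).+1 :> nat.
    by rewrite !gamE /= E0 -subSn // -E0.
  have := congr1 val Ek; rewrite /= rotpXE E => <-.
  rewrite addSn -[(_ %% _).+1]addn1 -[(_ + _).+1]addn1 -modnDml modn_small //.
  by rewrite addn1 -(rotpXE k) Ek -E.
by rewrite -col_conj !(closedM, unitsM) ?groupV.
Qed.

Hypothesis eidM : forall i, eid i \in M.
Hypothesis colM : forall i j, j = i.+1 :> nat -> col i j \in M.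

Lemma mono_total_sub f : {homo f : i j / i <= j} -> tot f \in M.
Proof.
have [m] := ubnP (disp f); elim: m f => // m IH f.
have step (h : 'I_n -> 'I_n) : {homo h : i j / i <= j} -> disp h < m.+1 ->
    (exists i, i < h i) -> tot h \in M.
  move=> mh hm /(mono_total_step mh)[i [j [h' [Eij mh' lt_h ->]]]].
  by apply: closedM; [apply: colM | apply: IH => //; apply: leq_trans lt_h _].
move=> fm mf.
case: (boolP [exists i : 'I_n, i < f i]) => [/existsP|]; first exact: step.
rewrite negb_exists => /forallP le_f.
(* conjugation by gamma exchanges the points moved up and the points moved down *)
case: (boolP [exists i : 'I_n, f i < i]) => [/existsP[i lt_i]|].
  have : tot (fun i => gam n (f (gam n i))) \in M.
    apply: step; rewrite ?disp_gam //.
      move=> k l kl; rewrite !gamE /= leq_sub2l // ltnS mf //= leq_sub2l //.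
    exists (gam n i); rewrite -permM gamK perm1 !gamE /=.
    by rewrite ltn_sub2lE // ltnS.
  rewrite tot_gam => H.
  have -> : tot f = pp (gam n) ** (pp (gam n) ** tot f ** pp (gam n)) ** pp (gam n).
    by rewrite !pt_mulA gamgam -ppM gamK pp1 pt_mul1r.
  have Mg := unitsM (gam_dihedral n).
  exact: closedM (closedM Mg H) Mg.
rewrite negb_exists => /forallP ge_f.
suff -> : tot f = pt_one n by [].
apply/ffunP=> i; rewrite !ffunE; congr Some; apply/val_inj/eqP.
by rewrite eqn_leq leqNgt le_f leqNgt ge_f.
Qed.

Lemma partial_id_sub A : [ffun i => if i \in A then Some i else None] \in M.
Proof.
have [m] := ubnP #|~: A|; elim: m A => // m IH A.
have [AT|[i]] := set_0Vmem (~: A).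
  move=> _; suff -> : [ffun i => if i \in A then Some i else None] = pt_one n by [].
  by apply/ffunP=> i; rewrite !ffunE -(setCK A) AT setC0 in_setT.
rewrite inE => iA; rewrite ltnS => /(leq_trans _) H.
have /IH MA : #|~: (i |: A)| < m.
  apply: H; rewrite setCU (cardsD1 i (~: A)) !inE iA add1n ltnS.
  by rewrite subset_leq_card //; apply/subsetP=> k; rewrite !inE.
suff -> : [ffun k => if k \in A then Some k else None] =
    [ffun k => if k \in i |: A then Some k else None] ** eid i by apply: closedM.
apply/ffunP=> k; rewrite pt_mulE !ffunE !inE; case: (eqVneq k i) => [->|ki] /=.
  by rewrite (negPf iA) ffunE eqxx.
by case: ifP => //= _; rewrite ffunE (negPf ki).
Qed.

(** A monotone partial map b is the restriction of the monotone total map sending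
    i to the largest value of b on the points j <= i (and to 0 if there is none). *)
Lemma mono_sub b : mono b -> b \in M.
Proof.
move=> mb; case: (posnP n) => [n0|n_gt0].
  suff -> : b = pt_one n by []. 
  by apply/ffunP=> i; have := leq_ltn_trans (leq0n i) (ltn_ord i); rewrite [X in _ < X]n0.
pose v i := if b i is Some x then val x else 0.
have v_lt i : v i < n by rewrite /v; case: (b i) => [x|] //=.
pose f i := insubd (Ordinal n_gt0) (\max_(j < n | j <= i) v j).
have fE i : f i = \max_(j < n | j <= i) v j :> nat.
  rewrite /f val_insubd; case: ifP => //= /negP[].
  apply: (@leq_ltn_trans n.-1); last by rewrite ltn_predL.
  by apply/bigmax_leqP=> j _; rewrite -ltnS prednK.
have mf : {homo f : i j / i <= j}.
  move=> i j ij; rewrite !fE; apply/bigmax_leqP=> k ki.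
  by rewrite (leq_bigmax_cond (F := v)) // (leq_trans ki).
have -> : b = [ffun i => if i \in pt_dom b then Some i else None] ** tot f.
  apply/ffunP=> i; rewrite pt_mulE ffunE inE; case Ei: (b i) => [x|] //=.
  rewrite ffunE; congr Some; apply/val_inj/eqP; rewrite /= fE eqn_leq.
  have -> : x <= \max_(j < n | j <= i) v j.
    by have := @leq_bigmax_cond _ (fun j : 'I_n => j <= i) v i (leqnn i); rewrite /v Ei.
  apply/bigmax_leqP=> j ji; rewrite /v; case Ej: (b j) => [y|] //.
  exact: mb Ej Ei ji.
by apply: closedM; [apply: partial_id_sub | apply: mono_total_sub].
Qed.

Lemma POR_sub : POR n \subset M.
Proof.
have opM b : op b -> b \in M.
  case/op_decomp=> k [c [mc ->]].
  by apply: closedM; [apply/unitsM/rotpX_dihedral | apply: mono_sub].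
apply/subsetP=> a /PORP[/opM //|[b /opM Mb ->]].
by apply: closedM => //; apply/unitsM/gam_dihedral.
Qed.

End InSubsemigroup.

Lemma POR_closed : pt_closed (POR n).
Proof. by move=> a b; apply: POR_mul. Qed.

Lemma eid_POR i : eid i \in POR n.
Proof.
apply/op_POR/mono_op=> k l x y; rewrite !ffunE.
by case: ifP => // _ [<-]; case: ifP => // _ [<-].
Qed.

Lemma col_POR i j : j = i.+1 :> nat -> col j i \in POR n.
Proof.
move=> Ej; apply/op_POR/mono_op=> k l x y; rewrite !ffunE => -[<-] [<-].
case: eqP => [->|/eqP kj]; case: eqP => [->|/eqP lj] //; rewrite Ej => kl.
  exact: ltnW.
by rewrite -ltnS -Ej ltn_neqAle kj Ej.
Qed.

(** An element of rank n - 1 that is not total is injective. *)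
Lemma POR_gen M a b : 0 < n -> pt_closed M -> M \subset POR n ->
  (forall g, g \in dihedral n -> pp g \in M) ->
  a \in M -> pt_rank a = n.-1 -> pt_dom a <> setT ->
  b \in M -> pt_rank b = n.-1 -> pt_dom b = setT -> M = POR n.
Proof.
move=> n_gt0 cM sM uM Ma ra da Mb rb db; apply/eqP; rewrite eqEsubset sM /=.
have M1 : pt_one n \in M by rewrite -pp1 uM.
have [i Mi] : exists i, eid i \in M.
  have [g [h [f [gD hD [w [wz _ _ Hw]]]]]] := rank_pred_struct n_gt0 (subsetP sM _ Ma) ra.
  case=> [[_ [i Ef]]|[]] //; exists i; rewrite -Ef -wz; apply: (cM); last first.
    by rewrite !(cM, uM).
  by apply: Hw => //; rewrite !(cM, uM).
have [j [k [Ek Mc]]] : exists i j, j = i.+1 :> nat /\ col j i \in M.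
  have [g [h [f [gD hD [w [wz _ _ Hw]]]]]] := rank_pred_struct n_gt0 (subsetP sM _ Mb) rb.
  case=> [[]|[_ [j [k [Ek Ef]]]]] //; exists j, k; split=> //.
  rewrite -Ef -wz; apply: (cM); last by rewrite !(cM, uM).
  by apply: Hw => //; rewrite !(cM, uM).
apply: POR_sub => //; first exact: (eid_all cM uM Mi).
exact: (col_all cM uM Ek Mc).
Qed.

End Generation.

(** * Subsemigroups and Green's relations *)

Section SemigroupTheory.

Variable n : nat.
Implicit Types (S M N : {set PT n}) (x y : PT n).

Lemma subsemigroupP S M :
  reflect [/\ M != set0, M \subset S & pt_closed M] (subsemigroup S M).
Proof.
apply: (iffP and3P) => -[M0 MS cM]; split=> //.
  by move=> x y Mx My; move/forall_inP/(_ x Mx)/forall_inP: cM; apply.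
by apply/forall_inP=> x Mx; apply/forall_inP=> y My; apply: cM.
Qed.

Lemma maximal_subsemigroupP S M :
  reflect [/\ subsemigroup S M, M \proper S
            & forall N, subsemigroup S N -> N \proper S -> M \subset N -> N = M]
    (maximal_subsemigroup S M).
Proof.
apply: (iffP maxsetP) => [[/andP[sM pM] H]|[sM pM H]].
  by split=> // N sN pN; apply: H; rewrite sN.
by split=> [|N /andP[sN pN]]; [rewrite sM | apply: H].
Qed.

Variable S : {set PT n}.
Hypotheses (closedS : pt_closed S) (S1 : pt_one n \in S).

(** x is in the principal ideal of the monoid S generated by y. *)
Definition Jle x y := exists s t, [/\ s \in S, t \in S & x = s ** y ** t].

Lemma Jle_trans y x z : Jle x y -> Jle y z -> Jle x z.
Proof.
case=> s [t [Ss St ->]] [s' [t' [Ss' St' ->]]].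
by exists (s ** s'), (t' ** t); rewrite !closedS // !pt_mulA.
Qed.

Lemma greenJP x y : reflect (Jle x y /\ Jle y x) (greenJ S x y).
Proof.
have self z : z \in [set s ** z ** t | s in S, t in S].
  by apply/imset2P; exists (pt_one n) (pt_one n); rewrite ?pt_mul1r ?pt_mulr1.
have sub u v : Jle u v ->
    [set s ** u ** t | s in S, t in S] \subset [set s ** v ** t | s in S, t in S].
  move=> uv; apply/subsetP=> _ /imset2P[s t Ss St ->].
  have : Jle (s ** u ** t) u by exists s, t.
  by move/Jle_trans/(_ uv) => [s' [t' [? ? ->]]]; apply/imset2P; exists s' t'.
apply: (iffP eqP) => [E|[xy yx]]; last by apply/eqP; rewrite eqEsubset !sub.
split; [have := self x; rewrite E|have := self y; rewrite -E];
  by case/imset2P=> s t ? ? ->; exists s, t.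
Qed.

Lemma greenR_mul x y : greenR S x y -> exists2 s, s \in S & x = y ** s.
Proof.
move/eqP=> E; have : x \in [set y ** s | s in S].
  by rewrite -E; apply/imsetP; exists (pt_one n); rewrite ?pt_mulr1.
by case/imsetP=> s; exists s.
Qed.

Lemma greenR_sym x y : greenR S x y = greenR S y x.
Proof. exact: eq_sym. Qed.

Lemma greenR_refl x : greenR S x x. Proof. exact: eqxx. Qed.

End SemigroupTheory.

(** * The maximal subsemigroups of POR n *)

Section Classification.

Variable n : nat.
Hypothesis n_ge2 : 2 <= n.
Implicit Types (a b x y : PT n) (M N : {set PT n}) (i j : 'I_n) (G H L : {group 'S_n}).

Let n_gt0 : 0 < n := ltnW n_ge2.

Local Notation U := (pt_group (dihedral n)).

(** The non-units of POR n together with the units from the group L. *)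
Definition adjoin_units L : {set PT n} := (POR n :\: U) :|: pt_group L.

(** The elements of rank n - 1 that are total, or not total, according to t. *)
Definition rank_pred (t : bool) : {set PT n} :=
  [set a in POR n | (pt_rank a == n.-1) && ((pt_dom a == setT) == t)].

Definition without_rank_pred t := POR n :\: rank_pred t.

Lemma POR1 : pt_one n \in POR n.
Proof. exact/op_POR/one_op. Qed.

Lemma mem_pt_group L g : (pp g \in pt_group L) = (g \in L).
Proof. by rewrite mem_imset //; apply: pp_inj. Qed.

Lemma mem_units a : (a \in U) = (a \in POR n) && (pt_rank a == n).
Proof.
apply/imsetP/andP=> [[g gD ->]|[Sa /eqP ra]].
  by rewrite dihedral_POR // pt_rank_pp eqxx.
by have [g gD ->] := POR_rank_n Sa ra; exists g.
Qed.

(** The non-units form an ideal. *)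
Lemma units_factor a b : a \in POR n -> b \in POR n -> a ** b \in U ->
  (a \in U) && (b \in U).
Proof.
rewrite !mem_units => -> -> /andP[_ /eqP E] /=.
by have := pt_rankMl a b; have := pt_rankMr a b; rewrite E !eqn_leq !pt_rank_le => -> ->.
Qed.

Lemma rotp_neq1 : rotp n != 1%g.
Proof.
apply/eqP=> /permP/(_ (Ordinal n_gt0))/(congr1 val).
by rewrite perm1 /= -[rotp n]expg1 rotpXE add0n modn_small.
Qed.

Lemma adjoin_units_mem L g : g \in dihedral n -> (pp g \in adjoin_units L) = (g \in L).
Proof.
by move=> gD; rewrite in_setU in_setD mem_pt_group !mem_pt_group gD.
Qed.

Lemma adjoin_units_sub L : L \subset dihedral n -> adjoin_units L \subset POR n.
Proof.
move=> sL; apply/subsetP=> a; rewrite in_setU in_setD => /orP[/andP[_ //]|].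
by case/imsetP=> g /(subsetP sL) gD ->; apply: dihedral_POR.
Qed.

Lemma adjoin_units_sg L : L \subset dihedral n -> subsemigroup (POR n) (adjoin_units L).
Proof.
move=> sL; have sS := adjoin_units_sub sL; apply/subsemigroupP; split=> //.
  by apply/set0Pn; exists (pp 1%g); rewrite adjoin_units_mem ?group1.
move=> a b Ma Mb; have Sab := POR_mul (subsetP sS _ Ma) (subsetP sS _ Mb).
have [Uab|nU] := boolP (a ** b \in U); last by rewrite in_setU in_setD nU Sab.
case/andP: (units_factor (subsetP sS _ Ma) (subsetP sS _ Mb) Uab).
case/imsetP=> g gD Ea /imsetP[h hD Eb]; move: Ma Mb; rewrite Ea Eb -ppM.
by rewrite !adjoin_units_mem ?(groupM gD hD) //; apply: groupM.
Qed.

Lemma adjoin_units_proper L : L \proper dihedral n -> adjoin_units L \proper POR n.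
Proof.
case/properP=> sL [g gD gL]; apply/properP; split; first exact: adjoin_units_sub.
by exists (pp g); rewrite ?dihedral_POR ?adjoin_units_mem.
Qed.

Lemma adjoin_units_subset L H : L \subset dihedral n ->
  (adjoin_units L \subset adjoin_units H) = (L \subset H).
Proof.
move=> sL; apply/idP/idP=> [/subsetP s|s]; last by rewrite setUS ?imsetS.
apply/subsetP=> g gL; have gD := subsetP sL _ gL.
by have := s (pp g); rewrite !adjoin_units_mem //; apply.
Qed.

Lemma adjoin_units_inj L H : L \subset dihedral n -> H \subset dihedral n ->
  adjoin_units L = adjoin_units H -> L = H.
Proof.
move=> sL sH E; apply/val_inj/eqP => /=; rewrite eqEsubset.
by rewrite -(adjoin_units_subset _ sL) -(adjoin_units_subset _ sH) E subxx.
Qed.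

Lemma units_groupP N : pt_closed N -> pt_one n \in N -> exists2 G : {group 'S_n},
  G \subset dihedral n & forall g, g \in dihedral n -> (g \in G) = (pp g \in N).
Proof.
move=> cN N1; have gS : group_set [set g in dihedral n | pp g \in N].
  apply/group_setP; rewrite inE pp1 N1 group1; split=> // x y.
  rewrite in_set => /andP[xD Nx]; rewrite in_set => /andP[yD Ny].
  by rewrite in_set ppM cN // groupM.
exists (group gS) => [|g gD]; last by rewrite /= in_set gD.
by apply/subsetP=> g; rewrite /= in_set => /andP[].
Qed.

Lemma adjoin_units_maximal L :
  maximal L (dihedral n) -> maximal_subsemigroup (POR n) (adjoin_units L).
Proof.
case/maxgroupP=> pL maxL; have sL := proper_sub pL.
apply/maximal_subsemigroupP; split; [exact: adjoin_units_sg|exact: adjoin_units_proper|].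
move=> N /subsemigroupP[_ sN cN] pN sLN.
have N1 : pt_one n \in N.
  by rewrite -pp1 (subsetP sLN) // adjoin_units_mem ?group1.
have [G sG GE] := units_groupP cN N1.
have EN : N = adjoin_units G.
  apply/eqP; rewrite eqEsubset; apply/andP; split; apply/subsetP=> a Ha.
    have [/imsetP[g gD Ea]|nU] := boolP (a \in U); last first.
      by rewrite in_setU in_setD nU (subsetP sN).
    by rewrite Ea adjoin_units_mem // GE // -Ea.
  move: Ha; rewrite in_setU => /orP[Ha|/imsetP[g gG ->]].
    by apply: (subsetP sLN); rewrite in_setU Ha.
  by rewrite -GE // (subsetP sG).
have pG : G \proper dihedral n.
  rewrite properEneq sG andbT; apply: contraTneq pN => EG; rewrite EN properE negb_and negbK.
  rewrite orbC; apply/orP; left; apply/subsetP=> a Sa; rewrite in_setU in_setD Sa andbT.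
  by case: (boolP (a \in U)) => // /imsetP[g gD ->]; rewrite mem_pt_group EG.
have GL : G = L by apply/val_inj/maxL; rewrite // -(adjoin_units_subset _ sL) -EN.
by rewrite EN GL.
Qed.

(** The units of M together with the identity, which M might lack, form a group; it
    is proper, since r and its inverse would otherwise both be in M, hence so would
    the identity. *)
Lemma maximal_adjoin_units M : maximal_subsemigroup (POR n) M -> ~~ (U \subset M) ->
  exists2 L : {group 'S_n}, maximal L (dihedral n) & M = adjoin_units L.
Proof.
case/maximal_subsemigroupP=> /subsemigroupP[_ sM cM] pM maxM nUM.
have cN : pt_closed (pt_one n |: M).
  move=> a b /setU1P[->|Ma]; first by rewrite pt_mul1r.
  case/setU1P=> [->|Mb]; first by rewrite pt_mulr1 setU1r.
  by rewrite setU1r ?cM.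
have [G sG GE] := units_groupP cN (setU11 _ _).
have pG : G \proper dihedral n.
  rewrite properEneq sG andbT; apply: contraNneq nUM => EG.
  have Mg g : g \in dihedral n -> g != 1%g -> pp g \in M.
    move=> gD; rewrite -(inj_eq (@pp_inj n)) pp1; move: (gD); rewrite -{1}EG GE //.
    by case/setU1P=> [->|//]; rewrite eqxx.
  apply/subsetP=> _ /imsetP[g gD ->]; have [->|] := eqVneq g 1%g; last exact: Mg.
  rewrite -(mulgV (rotp n)) ppM; apply: (cM); apply: Mg;
    by rewrite ?invg_eq1 ?rotp_neq1 ?groupV ?rotp_dihedral.
have EM : M = adjoin_units G.
  apply/esym/maxM; [exact: adjoin_units_sg|exact: adjoin_units_proper|].
  apply/subsetP=> a Ma.
  have [/imsetP[g gD Ea]|nU] := boolP (a \in U); last first.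
    by rewrite in_setU in_setD nU (subsetP sM).
  by rewrite Ea adjoin_units_mem // GE // -Ea setU1r.
exists G => //; apply/maxgroupP; split=> // H pH sGH.
congr (gval _); apply: adjoin_units_inj => //; first exact: proper_sub.
rewrite -EM; apply: maxM; rewrite ?adjoin_units_sg ?adjoin_units_proper ?(proper_sub pH) //.
by rewrite EM adjoin_units_subset.
Qed.

(** * Removing elements of rank n - 1 *)

Lemma card_dom_inj a : pt_rank a = n.-1 -> dinjectiveb a (pt_dom a) = (pt_dom a != setT).
Proof.
move=> ra; apply/dinjectiveP/idP=> [/pt_injP|dT].
  by apply: contraTneq => ->; rewrite ra cardsT card_ord neq_ltn ltn_predL n_gt0.
apply/pt_injP; rewrite eqn_leq pt_rank_dom ra -ltnS prednK //.
by rewrite -[X in _ < X]card_ord -cardsT proper_card // properT.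
Qed.

Lemma rank_predE t a : (a \in rank_pred t) =
  [&& a \in POR n, pt_rank a == n.-1 & (pt_dom a == setT) == t].
Proof. by rewrite in_set. Qed.

Lemma OR_rank_pred : [set a in OR n | pt_rank a == n - 1] = rank_pred true.
Proof.
apply/setP=> a; rewrite rank_predE in_set in_set subn1 eqb_id.
by rewrite -andbA [(pt_dom a == _) && _]andbC.
Qed.

Lemma PORI_rank_pred : [set a in PORI n | pt_rank a == n - 1] = rank_pred false.
Proof.
apply/setP=> a; rewrite rank_predE in_set in_set subn1 eqbF_neg.
rewrite -andbA [dinjectiveb _ _ && _]andbC; congr (_ && _).
by case: eqP => //= ra; rewrite card_dom_inj.
Qed.

Lemma dom_mul a b : pt_dom (a ** b) \subset pt_dom a.
Proof.
by apply/subsetP=> i; rewrite [i \in _]in_set pt_mulE inE; case: (a i).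
Qed.

Lemma dom_ppl (g : 'S_n) a : (pt_dom (pp g ** a) == setT) = (pt_dom a == setT).
Proof.
have key (h : 'S_n) b : pt_dom b = setT -> pt_dom (pp h ** b) = setT.
  move=> bT; apply/setP=> i; rewrite in_setT inE pt_mulE ppE /=.
  by have [j ->] := pt_dom_setT (h i) bT.
apply/eqP/eqP; last exact: key.
by rewrite -{2}(pt_ppKl g a); apply: key.
Qed.

(** This makes the complement of each of the two sets a subsemigroup. *)
Lemma rank_pred_prime t a b : a \in POR n -> b \in POR n ->
  a ** b \in rank_pred t -> (a \in rank_pred t) || (b \in rank_pred t).
Proof.
rewrite !rank_predE => Sa Sb /and3P[_ /eqP rab dab]; rewrite Sa Sb /=.
have := pt_rankMl a b; rewrite rab leq_eqVlt => /orP[/eqP ra|]; last first.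
  (* a has rank n, so it is a unit *)
  rewrite prednK // => ra; have {}ra : pt_rank a = n by apply/eqP; rewrite eqn_leq pt_rank_le.
  have [g _ Ea] := POR_rank_n Sa ra; move: rab dab; rewrite Ea pt_rank_ppl dom_ppl => -> ->.
  by rewrite eqxx orbT.
rewrite -ra eqxx /=; case: t dab; rewrite ?eqb_id ?eqbF_neg => dab.
  by rewrite -subTset -(eqP dab) dom_mul.
case: (eqVneq (pt_dom a) setT) => //= aT.
(* a identifies two points; both or neither are in the domain of a ** b, on which
   a ** b is injective: so neither is, and this domain is too small *)
have := card_dom_inj (esym ra); rewrite aT eqxx => /dinjectivePn[i _ [j]].
rewrite inE => /andP[ji _] Eij.
have := card_dom_inj rab; rewrite dab => /dinjectiveP inj_ab.
have dij : (i \in pt_dom (a ** b)) = (j \in pt_dom (a ** b)).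
  by rewrite [LHS]in_set [RHS]in_set !pt_mulE Eij.
have ni : i \notin pt_dom (a ** b).
  apply/negP=> di; have dj := di; rewrite dij in dj; case/eqP: ji.
  by apply: inj_ab => //; rewrite !pt_mulE Eij.
have nj := ni; rewrite dij in nj.
have : #|pt_dom (a ** b)| <= #|~: [set i; j]|.
  apply/subset_leq_card/subsetP=> k dk; rewrite in_setC in_set2 negb_or.
  by apply/andP; split; apply: contraTneq dk => ->.
move/(leq_trans (pt_rank_dom _)); rewrite rab => le.
have := cardsC [set i; j]; rewrite cards2 eq_sym ji card_ord => E.
by move: le; rewrite -[X in X.-1]E /= add1n ltnn.
Qed.

Lemma pt_rank_eid i : pt_rank (eid i) = n.-1.
Proof.
have dE : pt_dom (eid i) = [set~ i].
  by apply/setP=> k; rewrite !inE ffunE; case: (k == i).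
rewrite -[n in RHS]card_ord -(cardsC1 i) -dE; apply/eqP/pt_injP => k l.
by rewrite dE !inE !ffunE => /negPf-> /negPf-> [].
Qed.

Lemma pt_rank_col i j : i != j -> pt_rank (col i j) = n.-1.
Proof.
move=> ij; rewrite -[n in RHS]card_ord -(cardsC1 i).
congr #|pred_of_set _|; apply/setP=> k; rewrite !inE; apply/existsP/idP.
  by case=> l; rewrite ffunE => /eqP[<-]; case: (eqVneq l i) => // _; rewrite eq_sym.
by move=> ki; exists k; rewrite ffunE (negPf ki).
Qed.

Let i0 : 'I_n := Ordinal n_gt0.
Let i1 : 'I_n := Ordinal n_ge2.

Lemma eid_rank_pred i : eid i \in rank_pred false.
Proof.
rewrite rank_predE eid_POR pt_rank_eid eqxx eqbF_neg.
by apply/eqP=> /(pt_dom_setT i)[j]; rewrite ffunE eqxx.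
Qed.

Lemma col_rank_pred : col i1 i0 \in rank_pred true.
Proof.
rewrite rank_predE col_POR // pt_rank_col // eqxx eqb_id.
by apply/eqP/setP=> k; rewrite in_setT inE ffunE.
Qed.

Lemma rank_pred_ex t : exists a, a \in rank_pred t.
Proof.
by case: t; [exists (col i1 i0); apply: col_rank_pred
            |exists (eid i0); apply: eid_rank_pred].
Qed.

Lemma units_without t : U \subset without_rank_pred t.
Proof.
apply/subsetP=> a; rewrite mem_units in_setD rank_predE => /andP[-> /eqP->].
by rewrite gtn_eqF // ltn_predL.
Qed.

Lemma without_mem t a : a \in rank_pred t -> a \in without_rank_pred (~~ t).
Proof.
rewrite in_setD !rank_predE => /and3P[-> -> /eqP->]; by case: t.
Qed.

Lemma without_sg t : subsemigroup (POR n) (without_rank_pred t).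
Proof.
apply/subsemigroupP; split; last 1 first.
- move=> a b /setDP[Sa na] /setDP[Sb nb]; rewrite in_setD POR_mul // andbT.
  by apply/negP=> /(rank_pred_prime Sa Sb); rewrite (negPf na) (negPf nb).
- apply/set0Pn; exists (pp 1%g); rewrite (subsetP (units_without t)) //.
  by rewrite mem_pt_group group1.
exact: subsetDl.
Qed.

Lemma without_proper t : without_rank_pred t \proper POR n.
Proof.
apply/properP; split; first exact: subsetDl.
have [a Ra] := rank_pred_ex t; exists a; last by rewrite in_setD Ra.
by move: Ra; rewrite rank_predE => /andP[].
Qed.

Lemma POR_gen_rank_pred M a b : subsemigroup (POR n) M -> U \subset M ->
  a \in M -> a \in rank_pred false -> b \in M -> b \in rank_pred true -> M = POR n.
Proof.
case/subsemigroupP=> _ sM cM /subsetP UM Ma; rewrite rank_predE => /and3P[_ /eqP ra].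
rewrite eqbF_neg => /eqP da Mb; rewrite rank_predE => /and3P[_ /eqP rb].
rewrite eqb_id => /eqP db; apply: (POR_gen n_gt0 cM sM _ Ma ra da Mb rb db).
by move=> g gD; apply: UM; rewrite mem_pt_group.
Qed.

Lemma without_maximal t : maximal_subsemigroup (POR n) (without_rank_pred t).
Proof.
apply/maximal_subsemigroupP; split; [exact: without_sg|exact: without_proper|].
move=> N sN pN sub; apply/eqP; rewrite eqEsubset sub andbT; apply/subsetP=> a Na.
have Sa := subsetP (proper_sub pN) _ Na.
rewrite in_setD Sa andbT; apply: contraTN pN => Ra.
have UN := subset_trans (units_without t) sub.
have [b Rb] := rank_pred_ex (~~ t).
have Nb : b \in N by rewrite (subsetP sub) // -(negbK t) without_mem.
suff -> : N = POR n by rewrite properxx.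
by case: t {sub} Ra Rb => Ra Rb; [apply: (POR_gen_rank_pred sN UN Nb Rb Na Ra)
  |apply: (POR_gen_rank_pred sN UN Na Ra Nb Rb)].
Qed.

Lemma maximal_without M : maximal_subsemigroup (POR n) M -> U \subset M ->
  exists t, M = without_rank_pred t.
Proof.
case/maximal_subsemigroupP=> sM pM maxM UM.
have [t Ht] : exists t, forall a, a \in M -> a \notin rank_pred t.
  case: (boolP [exists a in M, a \in rank_pred false]) => [/exists_inP[a Ma Ra]|].
    exists true => b Mb; apply: contraTN pM => Rb.
    by rewrite (POR_gen_rank_pred sM UM Ma Ra Mb Rb) properxx.
  by move=> /exists_inPn H; exists false.
exists t; apply/esym/maxM; rewrite ?without_sg ?without_proper //.
by apply/subsetP=> a Ma; rewrite in_setD Ht // (subsetP (proper_sub pM)).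
Qed.

Lemma maximal_subsemigroup_POR M : maximal_subsemigroup (POR n) M <->
  [\/ exists2 L : {group 'S_n}, maximal L (dihedral n) & M = adjoin_units L,
      M = without_rank_pred true | M = without_rank_pred false].
Proof.
split=> [maxM|]; last first.
  by case=> [[L mL ->]|->|->]; [apply: adjoin_units_maximal|apply: without_maximal..].
have [UM|nUM] := boolP (U \subset M); last by constructor 1; apply: maximal_adjoin_units.
by have [[] ->] := maximal_without maxM UM; [constructor 2|constructor 3].
Qed.

(** * Types of the maximal subsemigroups *)

Local Notation Jle := (Jle (POR n)).
Let cS : pt_closed (POR n) := @POR_closed n.
Let S1 := POR1.

Lemma Jle_rank x y : Jle x y -> pt_rank x <= pt_rank y.
Proof.
by case=> s [t [_ _ ->]]; apply: leq_trans (pt_rankMl _ _) (pt_rankMr _ _).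
Qed.

Lemma Jle_units g h x : g \in dihedral n -> h \in dihedral n ->
  Jle (pp g ** x ** pp h) x /\ Jle x (pp g ** x ** pp h).
Proof.
move=> gD hD; split; first by exists (pp g), (pp h); rewrite !dihedral_POR.
exists (pp g^-1%g), (pp h^-1%g); rewrite !dihedral_POR ?groupV //.
by split=> //; rewrite -!pt_mulA ppKV pt_mulr1 pt_ppKl.
Qed.

(** The J-class of the identity is the group of units. *)
Lemma classJ_one : classJ (POR n) (pt_one n) = U.
Proof.
apply/setP=> x; rewrite in_set mem_units; apply: andb_id2l => Sx.
apply/greenJP/eqP=> // [[/Jle_rank]|rx].
  by rewrite -pp1 pt_rank_pp => rx _; apply/eqP; rewrite eqn_leq pt_rank_le.
have [g gD ->] := POR_rank_n Sx rx.
have := Jle_units (pt_one n) gD (group1 _).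
by rewrite pt_mulr1 pp1 pt_mulr1; case.
Qed.

(** All the elements of rank n - 1 are J-equivalent: for the idempotents
    eid j and col j i, one has eid j = eid j ** col j i and col j i = col j i ** eid j. *)
Lemma Jle_eid x : x \in POR n -> pt_rank x = n.-1 -> Jle x (eid i0) /\ Jle (eid i0) x.
Proof.
move=> Sx rx.
have eid_eid i : Jle (eid i) (eid i0) /\ Jle (eid i0) (eid i).
  have [k <-] := rotp_trans i0 i; rewrite -eid_conj.
  by apply: Jle_units; rewrite ?groupV rotpX_dihedral.
suff [f [[xf fx] [ff0 f0f]]] : exists f,
    (Jle x f /\ Jle f x) /\ (Jle f (eid i0) /\ Jle (eid i0) f).
  by split; [apply: Jle_trans xf ff0|apply: Jle_trans f0f fx].
have [g [h [f [gD hD [w [wz fz _ Hw]] Hf]]]] := rank_pred_struct n_gt0 Sx rx.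
set z := _ ** _ ** _ in wz fz Hw; have [zx xz] := Jle_units x gD hD.
have Sz : z \in POR n by rewrite !POR_mul ?dihedral_POR.
have Sw : w \in POR n by apply: Hw.
have fSz : Jle f z by exists w, (pt_one n); rewrite pt_mulr1.
have zSf : Jle z f by exists (pt_one n), z; rewrite pt_mul1r.
exists f; split; first by split; [apply: Jle_trans xz zSf|apply: Jle_trans fSz zx].
case: Hf => [[_ [i ->]]|[_ [i [j [Ej ->]]]]]; first exact: eid_eid.
have ij : i != j by rewrite -(inj_eq val_inj) /= Ej neq_ltn ltnSn.
have [jj0 j0j] := eid_eid j; split.
  apply: Jle_trans jj0 => //; exists (col j i), (pt_one n); rewrite col_POR // pt_mulr1.
  split=> //; apply/ffunP=> k; rewrite pt_mulE ffunE /= ffunE.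
  by case: (eqVneq k j) => [_|/negPf->] //; rewrite (negPf ij).
apply: Jle_trans j0j _ => //; exists (eid j), (pt_one n); rewrite eid_POR pt_mulr1.
split=> //; apply/ffunP=> k; rewrite pt_mulE ffunE.
by case: (eqVneq k j) => //= kj; rewrite ffunE (negPf kj).
Qed.

Lemma classJ_eid : classJ (POR n) (eid i0) = [set x in POR n | pt_rank x == n.-1].
Proof.
apply/setP=> x; rewrite [LHS]in_set [RHS]in_set; apply: andb_id2l => Sx.
apply/greenJP/eqP=> // [[/Jle_rank le1 /Jle_rank le2]|rx]; last first.
  by have [] := Jle_eid Sx rx.
by apply/eqP; rewrite eqn_leq -(pt_rank_eid i0) le1 le2.
Qed.

Lemma rank_pred_regular : regular_in (POR n) (classJ (POR n) (eid i0)).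
Proof.
move=> x; rewrite classJ_eid in_set => /andP[Sx /eqP rx].
have [g [h [f [gD hD [w [wz _ zf Hw]] _]]]] := rank_pred_struct n_gt0 Sx rx.
set z := _ ** _ ** _ in wz zf Hw.
have Sw : w \in POR n by apply: Hw; rewrite ?POR_mul ?dihedral_POR.
exists (pp h ** w ** pp g); first by rewrite !POR_mul ?dihedral_POR.
have Ex : x = pp g^-1%g ** z ** pp h^-1%g by rewrite /z -pt_mulA pt_ppKr pt_ppKl.
transitivity (pp g^-1%g ** (z ** (w ** z)) ** pp h^-1%g); last by rewrite wz zf -Ex.
by rewrite /z !pt_mulA ppVK pt_mul1r -!pt_mulA ppKV pt_mulr1.
Qed.

(** An R-class consists of maps with the same domain, so the total and the non-total
    elements of rank n - 1 are both unions of R-classes. *)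
Lemma without_M4 t : type_M4 (POR n) (without_rank_pred t).
Proof.
have rankJ x : (x \in classJ (POR n) (eid i0)) = (x \in POR n) && (pt_rank x == n.-1).
  by rewrite classJ_eid in_set.
have MJ x : (x \in without_rank_pred t :&: classJ (POR n) (eid i0)) = (x \in rank_pred (~~ t)).
  rewrite in_setI rankJ in_setD !rank_predE; case: (x \in _); rewrite ?andbF //=.
  by case: (_ == n.-1); rewrite ?andbF //= andbT; case: (_ == setT); case: t.
exists (classJ (POR n) (eid i0)); split.
- split; [exact: without_maximal|by exists (eid i0); rewrite ?eid_POR|].
  apply/subsetP=> x; rewrite in_setD in_setD rankJ negb_and negbK => /andP[H Sx].
  by move: H; rewrite Sx orbF rank_predE => /and3P[_ ->].
- exact: rank_pred_regular.
- by have [a Ra] := rank_pred_ex (~~ t); apply/set0Pn; exists a; rewrite MJ.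
exists [set classR (POR n) x | x in rank_pred (~~ t)].
  apply/subsetP=> _ /imsetP[x Rx ->]; move: Rx; rewrite rank_predE => /and3P[Sx rx _].
  by apply/imsetP; exists x; rewrite ?rankJ ?Sx.
apply/setP=> y; rewrite MJ; apply/idP/bigcupP=> [Ry|[_ /imsetP[x Rx ->]]].
  exists (classR (POR n) y); first by apply/imsetP; exists y.
  by rewrite in_set greenR_refl andbT; move: Ry; rewrite rank_predE => /andP[].
rewrite in_set => /andP[Sy Rxy].
have [s Ss Ex] := greenR_mul S1 Rxy.
rewrite greenR_sym in Rxy; have [u Su Ey] := greenR_mul S1 Rxy.
have Ed : pt_dom y = pt_dom x.
  by apply/eqP; rewrite eqEsubset {1}Ey dom_mul /= {1}Ex dom_mul.
have Er : pt_rank y = pt_rank x.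
  by apply/eqP; rewrite eqn_leq {1}Ey pt_rankMl /= {1}Ex pt_rankMl.
by move: Rx; rewrite !rank_predE Sy Ed Er => /andP[].
Qed.

Lemma adjoin_units_M5 L : maximal L (dihedral n) -> type_M5 (POR n) (adjoin_units L).
Proof.
move=> mL; exists (classJ (POR n) (pt_one n)); rewrite classJ_one; split.
- split; first exact: adjoin_units_maximal.
    by exists (pt_one n); rewrite ?POR1 ?classJ_one.
  apply/subsetP=> x; rewrite in_setD in_setU in_setD negb_or negb_and negbK.
  by case/andP=> /andP[/orP[//|/negPf->]].
- move=> _ /imsetP[g gD ->]; exists (pp g^-1%g); first by rewrite dihedral_POR ?groupV.
  by rewrite ppKV pt_mul1r.
move=> _ /imsetP[g gD ->]; apply/set0Pn; exists (pt_one n); rewrite in_setI.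
rewrite -{1}pp1 adjoin_units_mem ?group1 //= in_set POR1 /=.
have Sg := dihedral_POR gD; have SV : pp g^-1%g \in POR n by rewrite dihedral_POR ?groupV.
apply/andP; split; rewrite /greenR /greenL eqEsubset; apply/andP; split;
  apply/subsetP=> _ /imsetP[s Ss ->]; apply/imsetP.
- by exists (pp g ** s); rewrite ?POR_mul // pt_mul1r.
- by exists (pp g^-1%g ** s); rewrite ?POR_mul // pt_mulA ppKV.
- by exists (s ** pp g); rewrite ?POR_mul // pt_mulr1.
- by exists (s ** pp g^-1%g); rewrite ?POR_mul // -pt_mulA ppVK.
Qed.

End Classification.

(** * Maximal subgroups of the dihedral groups *)

Section MaximalDihedral.

Variable n : nat.
Hypothesis n_ge2 : 2 <= n.
Implicit Types (g h x : 'S_n) (L : {group 'S_n}) (p d j k : nat).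

Local Open Scope group_scope.
Local Notation r := (rotp n).
Local Notation c := (gam n).
Local Notation D := (dihedral n).
Local Notation C := <[r]>.

Let n_gt0 : (0 < n)%N := ltnW n_ge2.

Lemma order_rotp : #[r] = n.
Proof.
apply/eqP; rewrite eqn_dvd order_dvdn rotp_n eqxx /=.
have := rotpXE #[r] (Ordinal n_gt0); rewrite expg_order perm1 /= add0n => E.
by rewrite /dvdn -E.
Qed.

Lemma rotp_gam_rotp : r * c * r = c.
Proof.
apply/permP=> i; apply/val_inj; rewrite !permM !gamE /= -{1 2}(expg1 r) rotpXE /= rotpXE.
have : (i.+1 <= n)%N by apply: ltn_ord.
rewrite !addn1 leq_eqVlt => /orP[/eqP->|lt_in].
  by rewrite modnn subn1 prednK // modnn subnn.
rewrite (modn_small lt_in) -subSn // subSS modn_small //.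
by rewrite ltn_subrL.
Qed.

Lemma rotpX_gam k : c * r ^+ k = r ^- k * c.
Proof.
elim: k => [|k IH]; first by rewrite mulg1 invg1 mul1g.
rewrite {1}expgSr mulgA IH expgS invMg -!mulgA; congr (_ * _).
by rewrite -{2}rotp_gam_rotp -!mulgA mulKg.
Qed.

Lemma gamV : c^-1 = c.
Proof. by apply/eqP; rewrite eq_invg_mul gamK. Qed.

Lemma reflection_inv j : (r ^+ j * c) * (r ^+ j * c) = 1.
Proof. by rewrite -mulgA (mulgA c) rotpX_gam -mulgA gamK mulg1 mulgV. Qed.

Lemma rotpX_conj k j : (r ^+ k) ^ (r ^+ j * c) = r ^- k.
Proof.
rewrite conjgM [r ^+ k ^ (r ^+ j)]conjgE -expgD addnC expgD mulKg.
by rewrite conjgE gamV mulgA rotpX_gam -mulgA gamK mulg1.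
Qed.

(** The subgroup generated by the d-th power of the rotation and a reflection. *)
Definition dih_sub (d j : nat) := (<[r ^+ d]> <*> <[r ^+ j * c]>)%G.

Lemma dih_sub1 : D = dih_sub 1 0.
Proof.
apply/val_inj/eqP; rewrite /= eqEsubset gen_subG join_subG !cycle_subG expg1 mul1g.
rewrite rotp_dihedral gam_dihedral !andbT; apply/subsetP=> g.
rewrite in_set2 => /orP[]/eqP->; first by rewrite mem_gen // inE cycle_id.
by rewrite mem_gen // inE cycle_id orbT.
Qed.

Lemma reflection_dihedral j : r ^+ j * c \in D.
Proof. by rewrite groupM ?rotpX_dihedral ?gam_dihedral. Qed.

Lemma dih_sub_dihedral d j : dih_sub d j \subset D.
Proof. by rewrite join_subG !cycle_subG rotpX_dihedral reflection_dihedral. Qed.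

Section Nondegenerate.

(** For n >= 3 the reflection is not a power of the rotation. *)
Hypothesis n_ge3 : 3 <= n.

Lemma gam_notin_rot : c \notin C.
Proof.
apply/negP=> /cycleP[k Ek].
have n1 : (1 < n)%N by [].
have := congr1 (fun g : 'S_n => val (g (Ordinal n_gt0))) Ek.
have := congr1 (fun g : 'S_n => val (g (Ordinal n_ge2))) Ek.
rewrite /= !gamE /= !rotpXE /= add0n => E1 E0.
move: E1; rewrite addnC -modnDml -E0 subn1 addn1 prednK // modnn => /eqP.
by rewrite subn_eq0 leqNgt n_ge3.
Qed.

Lemma reflection_notin_rot j : r ^+ j * c \notin C.
Proof. by rewrite groupMl ?mem_cycle // gam_notin_rot. Qed.

Lemma order_reflection j : #[r ^+ j * c] = 2.
Proof.
apply: nt_prime_order => //; first by rewrite expgS expg1 reflection_inv.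
by apply: contraNneq (reflection_notin_rot j) => ->; rewrite group1.
Qed.

Lemma dih_subE d j : dih_sub d j = <[r ^+ d]> * <[r ^+ j * c]> :> {set 'S_n}.
Proof.
apply: norm_joinEr; rewrite cycle_subG; apply/normP.
rewrite -[RHS]cycleV; rewrite -cycleJ; congr <[_]>; exact: rotpX_conj.
Qed.

Lemma mem_dih_subP d j g : reflect
  (exists k, g = r ^+ (d * k) \/ g = r ^+ (d * k + j) * c) (g \in dih_sub d j).
Proof.
rewrite -[_ \in _]/(g \in (dih_sub d j : {set _})) dih_subE.
apply: (iffP mulsgP) => [[x y /cycleP[k ->]]|[k Ek]].
  rewrite (cycle2g (order_reflection j)) in_set2 => /orP[]/eqP-> ->; exists k.
    by left; rewrite mulg1 expgM.
  by right; rewrite mulgA expgD expgM.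
case: Ek => ->.
  by exists ((r ^+ d) ^+ k) 1; rewrite ?mem_cycle ?group1 ?mulg1 ?expgM.
by exists ((r ^+ d) ^+ k) (r ^+ j * c); rewrite ?mem_cycle ?cycle_id // mulgA expgD expgM.
Qed.

Lemma card_dih_sub d j : d %| n -> #|dih_sub d j| = (n %/ d * 2)%N.
Proof.
move=> dn; rewrite -[#|_|]/(#|(dih_sub d j : {set _})|) dih_subE TI_cardMg.
  by rewrite -!orderE order_reflection orderXdiv order_rotp.
rewrite setIC prime_TIg -?orderE ?order_reflection // cycle_subG.
apply: contra (reflection_notin_rot j); apply/subsetP.
by rewrite cycle_subG mem_cycle.
Qed.

Lemma card_dihedral : #|D| = (n * 2)%N.
Proof. by rewrite dih_sub1 card_dih_sub ?dvd1n // divn1. Qed.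

Lemma dihedralP g : g \in D -> exists k, g = r ^+ k \/ g = r ^+ k * c.
Proof.
by rewrite dih_sub1 => /mem_dih_subP[k]; rewrite mul1n addn0 => H; exists k.
Qed.

Lemma rot_maximal : maximal <[r]> D.
Proof.
have sC : C \subset D by rewrite cycle_subG rotp_dihedral.
by apply: p_index_maximal => //; rewrite -divgS // card_dihedral -orderE order_rotp mulKn.
Qed.

Lemma dih_sub_maximal p j : p \in primes n -> maximal (dih_sub p j) D.
Proof.
rewrite mem_primes => /and3P[pr_p _ pn].
apply: p_index_maximal (dih_sub_dihedral p j) _.
rewrite -divgS ?dih_sub_dihedral // card_dihedral card_dih_sub // divnMr //.
by rewrite divnA // mulKn.
Qed.

Lemma dih_sub_neq_rot p j : dih_sub p j <> <[r]>%G.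
Proof.
move=> E; have := reflection_notin_rot j; rewrite -[C]/(gval <[r]>%G) -E.
by rewrite mem_gen // inE cycle_id orbT.
Qed.

Lemma dih_sub_inj p j p' j' : p \in primes n -> p' \in primes n ->
  (j < p)%N -> (j' < p')%N -> dih_sub p j = dih_sub p' j' -> p = p' /\ j = j'.
Proof.
rewrite !mem_primes => /and3P[pr_p _ pn] /and3P[pr_p' _ pn'] jp jp' E.
have Ep : p = p'.
  have := congr1 (fun G : {group 'S_n} => #|G|) E; rewrite /= !card_dih_sub // => /eqP.
  rewrite eqn_pmul2r // => /eqP Ed.
  have n0 : (0 < n %/ p)%N by rewrite divn_gt0 ?prime_gt0 // dvdn_leq.
  by apply/eqP; rewrite -(eqn_pmul2l n0) {2}Ed !divnK.
split=> //; subst p'; have : r ^+ j * c \in dih_sub p j'.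
  by rewrite -E mem_gen // inE cycle_id orbT.
case/mem_dih_subP=> k [Ej|/mulIg/eqP].
  by have := reflection_notin_rot j; rewrite Ej mem_cycle.
rewrite eq_expg_mod_order order_rotp => /eqP/(congr1 (modn^~ p)).
by rewrite !modn_dvdm // (mulnC p) modnMDl !modn_small.
Qed.

(** If L is not contained in the rotations, it contains a reflection r ^ j gamma, and
    its rotations are the powers of r ^ d for a divisor d > 1 of n; for any prime p
    dividing d, L is then contained in the proper subgroup dih_sub p (j mod p). *)
Lemma maximal_dihedral L : maximal L D ->
  L = <[r]>%G \/ exists p j, [/\ p \in primes n, (j < p)%N & L = dih_sub p j].
Proof.
case/maxgroupP=> pL maxL; have sL := proper_sub pL.
have proper_max (H : {group 'S_n}) : H \proper D -> L \subset H -> L = H.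
  by move=> pH sH; apply/val_inj/esym/maxL.
case: (boolP (L \subset C)) => [sLC|].
  by left; apply: proper_max => //; have /maxgroupP[] := rot_maximal.
case/subsetPn=> g gL gC; right.
have [j Ej] : exists j, g = r ^+ j * c.
  by have [j [Eg|]] := dihedralP (subsetP sL _ gL); [rewrite Eg mem_cycle in gC|exists j].
have [d dn ELC] : exists2 d, d %| n & L :&: C = <[r ^+ d]>.
  have dv : #|L :&: C| %| #[r] by rewrite cardSg ?subsetIr.
  exists (#[r] %/ #|L :&: C|); first by move: dv; rewrite order_rotp; apply: dvdn_div.
  have /setP/(_ (L :&: C)%G) := cycle_sub_group dv.
  by rewrite !inE subsetIr eqxx => /esym/eqP/(congr1 val).
have d_neq1 : d != 1%N.
  apply: contraTneq pL => Ed; rewrite properE negb_and negbK orbC.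
  have rL : r \in L by have := cycle_id (r ^+ d); rewrite -ELC Ed expg1 inE => /andP[].
  have cL : c \in L by rewrite -(groupMl _ (groupX j rL)) -Ej.
  by rewrite gen_subG; apply/orP; left; apply/subsetP=> x; rewrite in_set2 => /orP[]/eqP->.
have d_gt1 : (1 < d)%N by rewrite ltn_neqAle eq_sym d_neq1 (dvdn_gt0 n_gt0 dn).
pose p := pdiv d; have pd : p %| d := pdiv_dvd d.
have pr_p : prime p := pdiv_prime d_gt1.
have pn : p \in primes n by rewrite mem_primes pr_p n_gt0 (dvdn_trans pd dn).
exists p, (j %% p)%N; rewrite ltn_mod prime_gt0 //; split=> //.
apply: proper_max; first by have /maxgroupP[] := dih_sub_maximal (j %% p) pn.
have sub x : x \in L -> x \in C -> x \in dih_sub p (j %% p).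
  move=> xL xC; have : x \in L :&: C by rewrite inE xL.
  rewrite ELC => /cycleP[k ->]; apply/mem_dih_subP; exists (d %/ p * k)%N; left.
  by rewrite -expgM mulnA (mulnC p) divnK.
apply/subsetP=> x xL; have [xC|nxC] := boolP (x \in C); first exact: sub.
have [k [Ex|Ex]] := dihedralP (subsetP sL _ xL); first by rewrite Ex mem_cycle in nxC.
rewrite -(mulgKV g x) groupM //.
  apply: sub; first by rewrite groupM ?groupV.
  by rewrite Ex Ej invMg mulgA mulgK groupM ?groupV ?mem_cycle.
rewrite Ej; apply/mem_dih_subP; exists (j %/ p)%N; right.
by rewrite (mulnC p) -divn_eq.
Qed.

Lemma card_maximal_dihedral :
  #|[set L : {group 'S_n} | maximal L D]| = (\sum_(p <- primes n) p + 1)%N.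
Proof.
pose s := <[r]>%G :: [seq dih_sub p j | p <- primes n, j <- iota 0 p].
have us : uniq s.
  rewrite /s /=; apply/andP; split.
    by apply/allpairsPdep=> -[p [j [_ _ /esym]]]; apply: dih_sub_neq_rot.
  apply: allpairs_uniq_dep => [||[p j] [p' j'] /=]; first exact: primes_uniq.
    by move=> p _; apply: iota_uniq.
  case/allpairsPdep=> q [i [qn]]; rewrite mem_iota /= => iq [-> ->].
  case/allpairsPdep=> q' [i' [qn']]; rewrite mem_iota /= => iq' [-> ->].
  by case/dih_sub_inj=> // <- <-.
have -> : #|[set L : {group 'S_n} | maximal L D]| = #|s|.
  apply: eq_card => L; rewrite in_set inE; apply/idP/predU1P.
    case/maximal_dihedral=> [|[p [j [pn jp ->]]]]; [by left|right].
    by apply/allpairsPdep; exists p, j; rewrite mem_iota.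
  case=> [->|/allpairsPdep[p [j [pn _ ->]]]]; [exact: rot_maximal|exact: dih_sub_maximal].
rewrite (card_uniqP us) /= size_allpairs_dep addn1; congr _.+1.
rewrite sumnE big_map; apply: eq_bigr => p _; exact: size_iota.
Qed.

End Nondegenerate.

End MaximalDihedral.

Lemma card_maximal_dihedral2 : #|[set L : {group 'S_2} | maximal L (dihedral 2)]| = 1.
Proof.
have E : gam 2 = rotp 2.
  by apply/permP=> -[[|[|//]] lt_i2]; apply/val_inj; rewrite /= !permE.
have ED : dihedral 2 = <[rotp 2]>%G.
  by apply/val_inj; rewrite /= -/(rotp 2) -/(gam 2) E setUid.
have oD : #|dihedral 2| = 2 by rewrite ED -[LHS]orderE order_rotp.
suff -> : [set L : {group 'S_2} | maximal L (dihedral 2)] = [set 1%G] by rewrite cards1.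
apply/setP=> L; rewrite in_set in_set1; apply/idP/eqP=> [/maxgroupP[pL _]|->].
  apply/val_inj/card1_trivg/eqP; rewrite eqn_leq cardG_gt0 andbT -ltnS -[X in _ < X]oD.
  exact: proper_card.
by apply: p_index_maximal; rewrite ?sub1G // indexg1 oD.
Qed.

(** * Counting, and the monoid POR 1 *)

Lemma card_maximal_subsemigroup_POR n : 2 <= n ->
  #|[set M : {set PT n} | maximal_subsemigroup (POR n) M]|
  = #|[set L : {group 'S_n} | maximal L (dihedral n)]| + 2.
Proof.
move=> n2; set X := [set L : {group 'S_n} | _].
have sX L : L \in X -> L \proper dihedral n by rewrite in_set => /maxgroupP[].
have Xw t : without_rank_pred n t \notin (@adjoin_units n) @: X.
  apply/imsetP=> -[L /sX /properP[_ [g gD gL]] E]; case/negP: gL.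
  rewrite -(adjoin_units_mem L gD) -E (subsetP (units_without n2 t)) //.
  by rewrite mem_pt_group.
have -> : [set M : {set PT n} | maximal_subsemigroup (POR n) M] =
    without_rank_pred n true |: (without_rank_pred n false |: (@adjoin_units n) @: X).
  apply/setP=> M; rewrite in_set !in_setU1.
  apply/idP/or3P=> [/(maximal_subsemigroup_POR n2)[[L mL ->]|->|->]|H].
  - by constructor 3; apply: imset_f; rewrite in_set.
  - by constructor 1.
  - by constructor 2.
  apply/(maximal_subsemigroup_POR n2); case: H => [/eqP|/eqP|/imsetP[L]].
  - by constructor 2.
  - by constructor 3.
  by rewrite in_set => mL ->; constructor 1; exists L.
have nw : without_rank_pred n true \notin
    (without_rank_pred n false |: (@adjoin_units n) @: X).
  rewrite in_setU1 negb_or Xw andbT.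
  have [a Ra] := rank_pred_ex n2 true.
  apply: contraTneq (without_mem Ra) => /= <-.
  by rewrite in_setD Ra.
rewrite cardsU1 nw.
rewrite cardsU1 Xw.
rewrite card_in_imset; first by rewrite addnA [RHS]addnC.
by move=> L H /sX /proper_sub sL /sX /proper_sub sH; apply: adjoin_units_inj.
Qed.

Lemma POR1E : POR 1 = [set: PT 1].
Proof.
apply/setP=> a; rewrite in_setT; apply/op_POR/mono_op=> i j x y _ _ _.
by rewrite !ord1.
Qed.

Lemma PT1_eq (a : PT 1) : a = pt_one 1 \/ a = [ffun=> None].
Proof.
case E: (a ord0) => [x|]; [left|right]; apply/ffunP=> i; rewrite !ffunE !ord1 E //.
by rewrite ord1.
Qed.

Lemma card_POR1 : #|POR 1| = 2.
Proof. by rewrite POR1E cardsT card_ffun card_option card_ord. Qed.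

Lemma PT1_idem (a : PT 1) : a ** a = a.
Proof.
by case: (PT1_eq a) => ->; rewrite ?pt_mul1r //; apply/ffunP=> i; rewrite !ffunE.
Qed.

Lemma semilattice_POR1 : semilattice (POR 1).
Proof.
apply/and3P; split.
- apply/subsemigroupP; split=> // [|x y _ _]; last by rewrite POR1E in_setT.
  by apply/set0Pn; exists (pt_one 1); rewrite POR1E in_setT.
- apply/forall_inP=> x _; apply/forall_inP=> y _; apply/eqP.
  case: (PT1_eq x) => ->; case: (PT1_eq y) => ->; rewrite ?pt_mul1r ?pt_mulr1 //.
by apply/forall_inP=> x _; rewrite PT1_idem.
Qed.

Lemma maximal_subsemigroup_POR1 (M : {set PT 1}) :
  maximal_subsemigroup (POR 1) M <-> exists2 a : PT 1, a \in POR 1 & M = [set a].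
Proof.
have sg a : subsemigroup (POR 1) [set a].
  apply/subsemigroupP; split; rewrite ?POR1E ?subsetT //.
    by apply/set0Pn; exists a; rewrite in_set1.
  by move=> x y /set1P-> /set1P->; rewrite PT1_idem in_set1.
have card1 (N : {set PT 1}) : N \proper POR 1 -> #|N| <= 1.
  by move/proper_card; rewrite card_POR1 ltnS.
split=> [/maximal_subsemigroupP[/subsemigroupP[/set0Pn[a Ma] sM _] /card1 cM _]|[a Sa ->]].
  exists a; first exact: (subsetP sM).
  by apply/esym/eqP; rewrite eqEcard sub1set Ma cards1.
apply/maximal_subsemigroupP; split=> //.
  by rewrite properEcard sub1set Sa cards1 card_POR1.
move=> N _ /card1 cN sN; apply/esym/eqP; by rewrite eqEcard sN cards1.
Qed.

Theorem theorem3p12 :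
  (forall n : nat, 2 <= n ->
     let D := pt_group (dihedral n) in
     let Ma (L : {group 'S_n}) := (POR n :\: D) :|: pt_group L in
     let Mb := POR n :\: [set a in OR n | pt_rank a == n - 1] in
     let Mc := POR n :\: [set a in PORI n | pt_rank a == n - 1] in
     [/\ forall M : {set PT n},
           maximal_subsemigroup (POR n) M <->
           [\/ exists2 L : {group 'S_n}, maximal L (dihedral n) & M = Ma L,
               M = Mb | M = Mc],
         forall L : {group 'S_n},
           maximal L (dihedral n) -> type_M5 (POR n) (Ma L),
         type_M4 (POR n) Mb
       & type_M4 (POR n) Mc])
  /\ #|[set M : {set PT 2} | maximal_subsemigroup (POR 2) M]| = 3
  /\ (forall n : nat, 3 <= n ->
        #|[set M : {set PT n} | maximal_subsemigroup (POR n) M]|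
        = \sum_(p <- primes n) p + 3)
  /\ [/\ POR 1 = [set: PT 1], semilattice (POR 1), #|POR 1| = 2
       & forall M : {set PT 1},
           maximal_subsemigroup (POR 1) M <->
           exists2 a : PT 1, a \in POR 1 & M = [set a]].
Proof.
split=> [n n2 D Ma Mb Mc|].
  rewrite /Mb /Mc (OR_rank_pred n) (PORI_rank_pred n2).
  split; [exact: maximal_subsemigroup_POR|exact: adjoin_units_M5|exact: without_M4..].
split; first by rewrite card_maximal_subsemigroup_POR // card_maximal_dihedral2.
split=> [n n3|].
  rewrite (card_maximal_subsemigroup_POR (ltnW n3)).
  by rewrite (card_maximal_dihedral (ltnW n3)) // -addnA.
split; [exact: POR1E|exact: semilattice_POR1|exact: card_POR1|].
exact: maximal_subsemigroup_POR1.
Qed.
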